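(* Let $C$ be a smooth projective algebraic curve, and let $A$ and $B$ be generalised weighted sets on $C$ of the same total multiplicity, equivalently (identifying each point of $C$ with the unique branch centred at it) divisors on $C$ of the same degree. Then $A\equiv B$ in the sense of linear equivalence of generalised weighted sets if and only if $A$ and $B$ are linearly equivalent as divisors in the usual (modern) sense, i.e. $A-B=div(g)$ for some $g\in L(C)^*$, where $div(g)$ is the usual divisor of $g$.
   Context: $L$ is an algebraically closed field of arbitrary characteristic. A (projective) algebraic curve is a closed irreducible subvariety $C\subset P^w$ of dimension $1$ over $L$, in general possibly singular; $L(C)$ is its function field. Branches: let $\nu:C^{ns}\to C$ be the non-singular model (normalisation). The branches $\gamma$ of $C$ centred at $p\in C$ correspond to (and may be identified with) the points $q\in\nu^{-1}(p)$; on a smooth curve each point is the centre of exactly one branch. For a form $\phi$ of degree $e$ on $P^w$ not vanishing identically on $C$, $I_\gamma(C,\phi)$ is the order of vanishing at $q$ of $\nu^*(\phi/l^e)$, where $l$ is a linear form with $l(p)\neq0$. An (effective) weighted set on $C$ is a finite formal sum $n_1\gamma_1+\dots+n_k\gamma_k$ of branches with non-negative integer coefficients; its total multiplicity is $n_1+\dots+n_k$. If $\phi$ has finite intersection with $C$, $C\sqcap\phi=\sum_\gamma I_\gamma(C,\phi)\gamma$, of total multiplicity $e\deg(C)$. A linear system $\Sigma$ is the projectivisation of a finite dimensional vector space of forms of a fixed degree $e$, its dimension being the projective dimension. $Series(\Sigma)$ is the collection of the $C\sqcap\phi$ for $\phi\in\Sigma$ having finite intersection with $C$ (at least one such form is assumed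 to exist); its order is $e\deg(C)$ and its dimension is the least integer $r$ such that every weighted set of $Series(\Sigma)$ is of the form $C\sqcap\phi$ with $\phi$ in some fixed linear subsystem $\Sigma'\subset\Sigma$ of dimension $r$. A $g_n^r$ on $C$ is a collection of weighted sets of the form $\{W-W_0:W\in Series(\Sigma)\}$, for some $\Sigma$ with $r=dimension(Series(\Sigma))$ and some (possibly zero) weighted set $W_0$ contained in every $W\in Series(\Sigma)$, where $n=order(Series(\Sigma))$ minus the total multiplicity of $W_0$. Linear equivalence of weighted sets: for effective weighted sets $A,B$ of the same total multiplicity $n$, $A\equiv B$ if there is a $g_n^r$ on $C$ (for some $r$) to which both $A$ and $B$ belong. A generalised weighted set is a finite formal sum of branches with integer coefficients; its total multiplicity is the sum of the coefficients. It can be written uniquely as $A_1-A_2$ with $A_1,A_2$ disjoint effective weighted sets. If $A=A_1-A_2$ and $B=B_1-B_2$ (in this unique form) have the same total multiplicity, then $A\equiv B$ is defined to mean $A_1+B_2\equiv B_1+A_2$ as effective weighted sets. *)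

(* Defs.v *)
From HB Require Import structures.
From mathcomp Require Import all_boot all_order all_algebra.
From mathcomp Require Export freeg mpoly.

Set Implicit Arguments.
Unset Strict Implicit.
Unset Printing Implicit Defensive.

Import Order.TTheory GRing.Theory Num.Theory.
Local Open Scope ring_scope.

(** * Projective space and its Zariski closed subsets *)

(* A point of P^w is encoded by its unique homogeneous coordinate vector whose
   first non-zero entry is 1. *)
Definition normalised (L : fieldType) (w : nat) (x : {ffun 'I_w.+1 -> L}) : bool :=
  [exists i, (x i == 1) && [forall j : 'I_w.+1, (j < i)%N ==> (x j == 0)]].

Record ppoint (L : fieldType) (w : nat) := PPoint {
  pcoord :> {ffun 'I_w.+1 -> L};
  _ : normalised pcoord
}.

HB.instance Definition _ (L : fieldType) (w : nat) :=
  [isSub for @pcoord L w].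
HB.instance Definition _ (L : fieldType) (w : nat) :=
  [Choice of ppoint L w by <:].

(* Forms of degree [d] on P^w, the zero form included; this type carries the
   library's structure of finite dimensional vector space over [L]. *)
Notation form L w d := (dhomog w.+1 L d).

Section VarietyDefs.

Variables (L : closedFieldType) (w : nat).
Implicit Types (C Z : {pred ppoint L w}) (p q : ppoint L w).

(* The value of a form at the normalised coordinates of a point. *)
Definition feval d (F : form L w d) p : L := (F : {mpoly L[w.+1]}).@[p].

Definition vanishes_on C d (F : form L w d) : Prop :=
  {in C, forall p, feval F p = 0}.

Definition zclosed Z : Prop :=
  exists T : forall d, form L w d -> Prop,
    forall p, p \in Z <-> (forall d (F : form L w d), T d F -> feval F p = 0).

Definition zirreducible C : Prop :=
  (exists p, p \in C) /\
  forall Z1 Z2, zclosed Z1 -> zclosed Z2 ->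
    {subset C <= [predU Z1 & Z2]} -> {subset C <= Z1} \/ {subset C <= Z2}.

(** * The function field *)

(* A representative F/G of an element of L(C): two forms of the same degree,
   the denominator not vanishing identically on C. *)
Record ratfun C := RatFun {
  rdeg : nat;
  rnum : form L w rdeg;
  rden : form L w rdeg;
  _ : ~ vanishes_on C rden
}.

(* Outside its intended domain [rden f != 0], [rval f] is 0. *)
Definition rval C (f : ratfun C) p : L := feval (rnum f) p / feval (rden f) p.

Coercion rval : ratfun >-> Funclass.

(* Equality in L(C): agreement on a non-empty open subset of C. Since C is
   irreducible, for representatives F1/G1 and F2/G2 this says that F1 G2 - F2 G1
   vanishes on C, and field operations may be computed pointwise. *)
Definition eq_gen C (h1 h2 : ppoint L w -> L) : Prop :=
  exists Z, [/\ zclosed Z, ~ {subset C <= Z}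
              & {in C, forall q, q \notin Z -> h1 q = h2 q}].

(* dim C = 1: L(C) has transcendence degree 1 over L. Since [t] is transcendental,
   an algebraic dependence of [f] over L(t) amounts, after clearing denominators,
   to a non-zero two-variable polynomial relation between [f] and [t]. *)
Definition dim_one C : Prop :=
  exists t : ratfun C,
    (forall P : {poly L}, eq_gen C (fun q => P.[t q]) (fun=> 0) -> P = 0) /\
    (forall f : ratfun C, exists2 P : {poly {poly L}},
       P != 0 & eq_gen C (fun q => P.[(f q)%:P].[t q]) (fun=> 0)).

End VarietyDefs.

Record curve (L : closedFieldType) (w : nat) := Curve {
  curve_set :> {pred ppoint L w};
  curve_closed : zclosed curve_set;
  curve_irreducible : zirreducible curve_set;
  curve_dim : dim_one curve_set
}.

Section CurveDefs.

Variables (L : closedFieldType) (w : nat) (C : curve L w).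

(* [tangent_vector p v] says that [v] lies in the linear subspace of L^(w+1) which
   is the affine cone over the projective tangent space of C at p. *)
Definition tangent_vector (p : ppoint L w) (v : 'rV[L]_w.+1) : Prop :=
  forall d (F : form L w d), vanishes_on C F ->
    \sum_(i < w.+1) (mderiv i (F : {mpoly L[w.+1]})).@[p] * v 0 i = 0.

(* Jacobian criterion: the projective tangent space at p is a line. *)
Definition smooth_at (p : ppoint L w) : Prop :=
  exists2 M : 'M[L]_(2, w.+1), \rank M = 2%N &
    forall v : 'rV[L]_w.+1, (v <= M)%MS <-> tangent_vector p v.

Definition smooth : Prop := {in C, forall p, smooth_at p}.

(** * Order of vanishing at a point of a smooth curve *)

(* [t] is a generator of the maximal ideal of the local ring of C at p: an element
   of this ring is one having a representative whose denominator is non-zero at p. *)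
Definition uniformizer (p : ppoint L w) (t : ratfun C) : Prop :=
  [/\ feval (rden t) p != 0, t p = 0 &
      forall f : ratfun C, feval (rden f) p != 0 -> f p = 0 ->
      exists2 g : ratfun C, feval (rden g) p != 0 &
        eq_gen C f (fun q => g q * t q)].

(* [h], viewed in L(C), is u t^n with [u] a unit of the local ring at p. *)
Definition ord_at (p : ppoint L w) (h : ppoint L w -> L) (n : int) : Prop :=
  exists t u : ratfun C,
    [/\ uniformizer p t, feval (rden u) p != 0, u p != 0 &
        eq_gen C h (fun q => u q * t q ^ n)].

(* I_p(C, phi) = n. *)
Definition inter_mult (p : ppoint L w) e (phi : form L w e) (n : int) : Prop :=
  exists2 l : form L w 1, feval l p != 0 &
    ord_at p (fun q => feval phi q / feval l q ^+ e) n.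

(** * Weighted sets *)

Local Notation curve_point := {p : ppoint L w | p \in C}.

(* On a smooth curve the normalisation is the identity and the branches are the
   points, so that generalised weighted sets and divisors are the same formal sums;
   [deg] is the total multiplicity. *)
Local Notation wset := {freeg curve_point / int}.

Definition effective (W : wset) : Prop := forall p, 0 <= coeff p W.

Definition finite_inter e (phi : form L w e) : Prop :=
  exists s : seq (ppoint L w), {in C, forall p, feval phi p = 0 -> p \in s}.

(* W is the weighted set cut out on C by phi. *)
Definition cuts e (phi : form L w e) (W : wset) : Prop :=
  finite_inter phi /\
  forall p : curve_point, inter_mult (val p) phi (coeff p W).

(* deg(C) = m: every hyperplane with finite intersection with C cuts out on C a
   weighted set of total multiplicity m. *)
Definition curve_degree (m : nat) : Prop :=
  forall l : form L w 1, finite_inter l -> exists2 W, cuts l W & deg W = m%:Z.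

(** * Linear series *)

(* A linear system of forms of degree e is given by the vector space [S] of which
   it is the projectivisation; its dimension is [(\dim S).-1]. *)
Definition in_series e (S : {vspace form L w e}) (W : wset) : Prop :=
  exists2 phi, phi \in S & cuts phi W.

Definition series_cut_by e (S : {vspace form L w e}) (r : nat) : Prop :=
  exists S' : {vspace form L w e},
    [/\ (S' <= S)%VS, \dim S' = r.+1 & forall W, in_series S W -> in_series S' W].

Definition series_dim e (S : {vspace form L w e}) (r : nat) : Prop :=
  series_cut_by S r /\ forall r', series_cut_by S r' -> (r <= r')%N.

Definition is_gnr (n r : nat) (G : wset -> Prop) : Prop :=
  exists e (S : {vspace form L w e}) (W0 : wset) (m : nat),
  [/\ (exists2 phi, phi \in S & finite_inter phi),
      series_dim S r,
      effective W0 /\ (forall W, in_series S W -> effective (W - W0)),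
      curve_degree m /\ n%:Z = (e * m)%:Z - deg W0 &
      forall V, G V <-> exists2 W, in_series S W & V = W - W0].

Definition lin_equiv_eff (A B : wset) : Prop :=
  exists n r G,
    [/\ effective A, effective B, deg A = n%:Z /\ deg B = n%:Z,
        is_gnr n r G & G A /\ G B].

(* [fgpos A] and [fgneg A] are the disjoint effective parts of A, with
   A = fgpos A - fgneg A. *)
Definition lin_equiv (A B : wset) : Prop :=
  deg A = deg B /\
  lin_equiv_eff (fgpos A + fgneg B) (fgpos B + fgneg A).

(* D = div(g). *)
Definition is_div (g : ratfun C) (D : wset) : Prop :=
  forall p : curve_point, ord_at (val p) g (coeff p D).

End CurveDefs.

Notation wset C := {freeg {p | p \in curve_set C} / int}.

(* Main.v *)
From HB Require Import structures.
Require Import Defs.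
From mathcomp Require Import all_boot all_order all_algebra.
From mathcomp Require Import boolp perm ring zify.
From mathcomp Require classical_sets.

Set Implicit Arguments.
Unset Strict Implicit.
Unset Printing Implicit Defensive.

Import Order.TTheory GRing.Theory Num.Theory.
Local Open Scope ring_scope.

(** The members of a g_n^r are cut out by forms up to a fixed part, so two of
    them differ by the divisor of a quotient of two forms of the same degree;
    this gives the direct implication, [lin_equiv_div]. Conversely, let
    A - B = div(F/G) and write A = A1 - A2, B = B1 - B2. Take a form H passing
    through A1 + B2 and consider the pencil spanned by FH and GH. Every member
    of its series contains W0 = div(FH) - (A1 + B2), because orders of vanishing
    satisfy the ultrametric inequality, and after removal of W0 the forms FH and
    GH cut out A1 + B2 and B1 + A2; this is [div_lin_equiv].

    The definition of a g_n^r refers to the degree m of C, so the argument needs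
    Bezout's theorem: a form of degree e cuts out a weighted set of total
    multiplicity e m ([degree_of_sections]). Let h(N) be the dimension of the
    space of forms of degree N modulo those vanishing on C. Containing a weighted
    set D imposes at most |D| linear conditions on forms ([dim_along_le]), and
    exactly |D| conditions in degrees at least |D| ([dim_along_eq]). If F and G
    have degree e and divisors D and E, then multiplication by F gives
    h(N + e) >= h(N) + |D| for large N, hence h(N0 + ke) >= h(N0) + k|D|, while
    h(ke) <= k|E| + 1, because a form of degree ke containing kE is, up to a
    constant factor, G^k on C. Letting k grow, |D| <= |E|, and by symmetry |D| = |E|.

    Three facts enter. The last inequality says that a regular function on C is
    constant ([regular_constant]): by the projective Nullstellensatz
    ([projective_nullstellensatz]) such a function multiplies the forms of some
    degree N, restricted to C, into themselves, so it is an eigenvalue of this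
    multiplication. Smoothness supplies local parameters
    ([local_parameter_exists]): by the Jacobian criterion a linear form generates
    the maximal ideal of the local ring modulo its square, and Nakayama's lemma
    applies. Finally dim C = 1 makes h grow at most linearly ([hilbert_growth]),
    which forces forms to have finitely many zeros on C, with finite orders. *)

(** * Linear algebra *)

(** A subspace of maximal dimension among those on which P holds must contain every
    vector satisfying P. *)
Lemma vspace_of_pred (K : fieldType) (V : vectType K) (P : V -> Prop) :
  P 0 -> (forall a u v, P u -> P v -> P (a *: u + v)) ->
  exists U : {vspace V}, forall v, v \in U <-> P v.
Proof.
move=> P0 Plin.
pose good n := `[< exists2 U : {vspace V}, \dim U = n & {in U, forall v, P v} >].
have ex : exists n, good n.
  exists 0; apply/asboolP; exists 0%VS; first exact: dimv0.
  by move=> v; rewrite memv0 => /eqP ->.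
have ub n : good n -> (n <= dim V)%N.
  by move=> /asboolP[U <- _]; rewrite -dimvf dimvS ?subvf.
case: (ex_maxnP ex ub) => n /asboolP[U dU PU] nmax.
exists U => v; split=> [|Pv]; first exact: PU.
apply: contrapT => /negP vU.
have /nmax : good (\dim (U + <[v]>)).
  apply/asboolP; exists (U + <[v]>)%VS => // _ /memv_addP[u uU [_ /vlineP[a ->] ->]].
  by rewrite addrC; apply: Plin => //; apply: PU.
rewrite leqNgt -dU => /negP; apply.
rewrite (ltn_leqif (dimv_leqif_sup (addvSl _ _))).
by apply: contra vU => /subvP; apply; rewrite -{1}[v]add0r memv_add ?mem0v ?memv_line.
Qed.

(** Dimension inequality for a linear map V -> X / Y with kernel in I, where the map
    is given only as a linear relation rho, so that no images have to be chosen
    linearly in advance. *)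
Lemma rel_dim (K : fieldType) (V W : vectType K) (rho : V -> W -> Prop)
    (I : {vspace V}) (X Y : {vspace W}) :
  rho 0 0 ->
  (forall a v v' w w', rho v w -> rho v' w' -> rho (a *: v + v') (a *: w + w')) ->
  (forall v, exists2 w, w \in X & rho v w) ->
  (forall v w, w \in Y -> rho v w -> v \in I) ->
  (Y <= X)%VS -> (\dim {:V} + \dim Y <= \dim X + \dim I)%N.
Proof.
move=> rho0 rholin tot inj YX.
set B := vbasis I^C.
have totB (i : 'I_(\dim I^C)) : exists w, w \in X /\ rho B`_i w.
  by have [w wX r] := tot B`_i; exists w.
have [wf wfP] := choice totB.
pose f v := \sum_i coord B i v *: wf i.
have flin : linear f.
  move=> a u v; rewrite /f scaler_sumr -big_split /=; apply: eq_bigr => i _.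
  by rewrite linearP scalerDl scalerA.
pose fL : {linear V -> W} := HB.pack f (GRing.isLinear.Build _ _ _ _ f flin).
pose F : 'Hom(V, W) := linfun fL.
have FE v : F v = f v by rewrite lfunE.
have rhoF v : v \in (I^C)%VS -> rho v (F v).
  move=> vI; rewrite FE {1}(coord_vbasis vI) /f -/B.
  apply: (big_rec2 rho) => // i w v' _; apply: rholin.
  by have [] := wfP i.
have FX : (F @: I^C <= X)%VS.
  apply/subvP => _ /memv_imgP[v vI ->]; rewrite FE /f.
  by apply: memv_suml => i _; apply: memvZ; have [] := wfP i.
have kF : (I^C :&: lker F = 0)%VS.
  apply/eqP; rewrite -subv0; apply/subvP => v; rewrite memv_cap memv_ker => /andP[vI /eqP Fv].
  have vI' : v \in I by apply: (inj v 0); rewrite ?mem0v // -Fv; apply: rhoF.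
  by rewrite -(capv_compl I) memv_cap vI' vI.
have FY : (F @: I^C :&: Y = 0)%VS.
  apply/eqP; rewrite -subv0; apply/subvP => _ /memv_capP[/memv_imgP[v vI ->] FvY].
  suff -> : v = 0 by rewrite linear0 mem0v.
  apply/eqP; rewrite -memv0 -(capv_compl I) memv_cap vI andbT.
  exact: (inj _ _ FvY (rhoF _ vI)).
have sub : (F @: I^C + Y <= X)%VS by rewrite subv_add FX YX.
have := dimvS sub; rewrite dimv_disjoint_sum // limg_dim_eq // dimv_compl => le.
rewrite -(@leq_add2r (\dim I)) in le; apply: leq_trans le.
by rewrite addnAC subnK // dimvS ?subvf.
Qed.

(** A linear relation defined everywhere induces, after choice of values on a basis
    of a complement of U, a square matrix on V / U; an eigenvector of this matrix
    is an eigenvector of rho modulo U. *)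
Lemma rel_eigenvector (L : closedFieldType) (V : vectType L) (U : {vspace V})
    (rho : V -> V -> Prop) :
  rho 0 0 ->
  (forall a v v' w w', rho v w -> rho v' w' -> rho (a *: v + v') (a *: w + w')) ->
  (forall v, exists w, rho v w) -> U != fullv ->
  exists a v u, [/\ v \notin U, u \in U & rho v (a *: v + u)].
Proof.
move=> rho0 rholin tot Uproper.
set r := \dim (U^C); set B := vbasis (U^C).
have r0 : (0 < r)%N.
  rewrite /r dimv_compl subn_gt0 ltn_neqAle dimvS ?subvf // andbT.
  by apply: contra Uproper; rewrite eqEdim subvf => /eqP ->; rewrite leqnn.
have [wf wfP] := choice (fun i : 'I_r => tot B`_i).
have dec i : exists c : V, c \in (U^C)%VS /\ wf i - c \in U.
  have : wf i \in (U + U^C)%VS by rewrite addv_complf memvf.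
  by case/memv_addP=> u uU [c cC ->]; exists c; rewrite addrK.
have [c cP] := choice dec.
pose M : 'M[L]_r := \matrix_(i, j) coord B j (c i).
have [a /eigenvalueP[x xM x0]] : exists a, eigenvalue M a.
  have [|a ra] := @closed_rootP L (char_poly M) _; last first.
    by exists a; rewrite eigenvalue_root_char.
  by rewrite size_char_poly eqSS -lt0n.
pose v := \sum_i x 0 i *: B`_i; pose u := \sum_i x 0 i *: (wf i - c i).
have vC : v \in (U^C)%VS.
  by apply: memv_suml => i _; apply: memvZ; rewrite vbasis_mem ?mem_nth ?size_tuple.
have v0 : v != 0.
  apply: contra x0 => /eqP v0; apply/eqP/rowP => i; rewrite mxE.
  have /freeP/(_ _ v0 i) // : free B by apply: basis_free (vbasisP _).
have uU : u \in U by apply: memv_suml => i _; apply: memvZ; have [] := cP i.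
exists a, v, u; split=> //.
  by apply: contra v0 => vU; rewrite -memv0 -(capv_compl U) memv_cap vU vC.
have -> : a *: v + u = \sum_i x 0 i *: wf i.
  rewrite /u; under eq_bigr => i _ do rewrite scalerBr.
  rewrite big_split /= sumrN addrCA -[RHS]addr0; congr (_ + _).
  apply/eqP; rewrite subr_eq0; apply/eqP.
  transitivity (\sum_j (x *m M) 0 j *: B`_j).
    by rewrite xM scaler_sumr; apply: eq_bigr => j _; rewrite mxE scalerA.
  rewrite (eq_bigr (fun j => \sum_i (x 0 i * M i j) *: B`_j)); last first.
    by move=> j _; rewrite mxE scaler_suml.
  rewrite exchange_big; apply: eq_bigr => i _.
  have [/coord_vbasis -> _] := cP i; rewrite scaler_sumr; apply: eq_bigr => j _.
  by rewrite mxE scalerA.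
by apply: (big_rec2 rho) => // i v' w _; apply: rholin.
Qed.

(** * Homogeneous polynomials and graded ideals *)

Section Homogeneous.

Variables (L : fieldType) (n : nat).
Implicit Types (F G : {mpoly L[n]}) (a : 'I_n -> L).

Lemma homogX i : ('X_i : {mpoly L[n]}) \is 1.-homog.
Proof. by rewrite dhomogX /= mdeg1. Qed.

Lemma homog_exp d F k : F \is d.-homog -> F ^+ k \is (d * k)%N.-homog.
Proof. exact: dhomogMn. Qed.

Lemma homogXn i k : ('X_i ^+ k : {mpoly L[n]}) \is k.-homog.
Proof. by rewrite -[k in k.-homog]mul1n homog_exp ?homogX. Qed.

Lemma meval_homogZ d F a c : F \is d.-homog ->
  F.@[fun i => c * a i] = c ^+ d * F.@[a].
Proof.
move=> /dhomogP hF; rewrite !mevalE mulr_sumr; apply: eq_big_seq => m mF.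
under eq_bigr => i _ do rewrite exprMn.
rewrite big_split /= prodrXr -mdegE.
rewrite -(hF m mF); rewrite mulrCA; congr (_ * _).
Qed.

Lemma homog0_meval F a : F \is 0.-homog -> F = F.@[a]%:MP.
Proof.
move=> /dhomogP hF; suff [c ->] : exists c, F = c%:MP by rewrite mevalC.
exists F@_0; apply/mpolyP => m; rewrite mcoeffC.
have [<-|/eqP m0] := eqVneq 0%MM m; first by rewrite mulr1.
rewrite mulr0; apply: contraTeq (erefl true); rewrite -mcoeff_msupp => mF.
by case: m0; apply/esym/eqP; rewrite -mdeg_eq0 (hF m mF).
Qed.

Lemma homogS_sum d F : F \is d.+1.-homog ->
  exists2 G : 'I_n -> {mpoly L[n]}, forall j, G j \is d.-homog & F = \sum_j 'X_j * G j.
Proof.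
move=> /dhomogP hF.
have pk m : m \in msupp F -> exists j : 'I_n, m j != 0%N.
  move=> mF; have : mdeg m != 0%N by rewrite (hF m mF).
  by rewrite mdeg_eq0 => m0; apply/existsP; apply: contraNT m0; rewrite negb_exists
     => /forallP z; apply/eqP/mnmP => j; rewrite mnmE; apply/eqP; have := z j; rewrite negbK.
exists (fun j => \sum_(m <- msupp F | [pick j | m j != 0%N] == Some j)
                    F@_m *: 'X_[(m - U_(j))%MM]).
  move=> j; rewrite big_seq_cond; apply: rpred_sum => m /andP[mF].
  case: pickP => // j' mj /eqP[ej]; rewrite rpredZ // dhomogX -ej; apply/eqP.
  have := hF m mF; rewrite -{1}(@submK _ U_(j')%MM m) ?lep1mP //=.
  by rewrite mdegD mdeg1 addn1 => -[].
rewrite {1}(mpolyE F).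
under [RHS]eq_bigr => j _ do rewrite big_mkcond mulr_sumr.
rewrite exchange_big; apply: eq_big_seq => m mF /=.
case: pickP => [j mj|z]; last by have [j] := pk m mF; rewrite z.
rewrite (bigD1 j) //= eqxx big1 ?addr0; last first.
  by move=> k kj; case: eqP => [[e]|]; [rewrite e eqxx in kj | rewrite mulr0].
by rewrite -scalerAr -mpolyXD addmC submK // lep1mP.
Qed.

(** The linear form 'X_j - a_j 'X_i; when a_i = 1 these forms generate the ideal of
    the point with homogeneous coordinates a. *)
Definition shift a i j : {mpoly L[n]} := 'X_j - a j *: 'X_i.

Lemma homog_shift a i j : shift a i j \is 1.-homog.
Proof. by rewrite rpredB ?rpredZ ?homogX. Qed.

(** Modulo the ideal of the point a every variable 'X_j is a_j 'X_i, so F becomes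
    F(a) 'X_i^(d+1). The coefficients G_j of the remainder are what the local study
    of the curve uses. *)
Lemma homog_taylor a i d F : a i = 1 -> F \is d.+1.-homog ->
  exists2 G : 'I_n -> {mpoly L[n]}, forall j, G j \is d.-homog &
    F = F.@[a] *: 'X_i ^+ d.+1 + \sum_j shift a i j * G j.
Proof.
move=> ai; elim: d F => [|d IH] F hF; have [G hG {1 2}->] := homogS_sum hF.
  exists G => //; rewrite raddf_sum scaler_suml -big_split /=; apply: eq_bigr => j _.
  rewrite mevalM mevalXU {1 3}(homog0_meval a (hG j)) /shift mulrBl.
  rewrite ![_ * (_)%:MP]mulrC !mul_mpolyC scalerA [_ * a j]mulrC expr1.
  by rewrite addrCA subrr addr0.
pose GG j := s2val (cid2 (IH _ (hG j))).
have GGP j : (forall k, GG j k \is d.-homog) /\ G j = (G j).@[a] *: 'X_i ^+ d.+1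
    + \sum_k shift a i k * GG j k by rewrite /GG; case: cid2.
exists (fun k => G k + \sum_j a j *: ('X_i * GG j k)).
  move=> k; apply: rpredD; [exact: hG | apply: rpred_sum => j _]; rewrite rpredZ //.
  by rewrite -[d.+1]add1n dhomogM ?homogX //; case: (GGP j).
have key : \sum_j a j *: ('X_i * G j) = (\sum_j 'X_j * G j).@[a] *: 'X_i ^+ d.+2
    + \sum_k shift a i k * \sum_j a j *: ('X_i * GG j k).
  rewrite raddf_sum scaler_suml.
  under [X in _ + X]eq_bigr => k _ do rewrite mulr_sumr.
  rewrite exchange_big -big_split; apply: eq_bigr => j _ /=.
  rewrite {1}(proj2 (GGP j)) mulrDr scalerDr; congr (_ + _).
    by rewrite mevalM mevalXU -scalerAr scalerA -exprS.
  rewrite mulr_sumr scaler_sumr; apply: eq_bigr => k _.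
  by rewrite -scalerAr mulrCA.
under [X in _ = _ + X]eq_bigr => k _ do rewrite mulrDr.
rewrite big_split /= addrCA -key -big_split /=; apply: eq_bigr => j _.
by rewrite /shift mulrBl -scalerAl subrK.
Qed.

(** Homogeneous ideals, as families indexed by the degree: J d F says that F is an
    element of degree d. The zero form belongs to every degree, so the degree
    cannot be recovered from the form. *)
Record graded_ideal (J : nat -> {mpoly L[n]} -> Prop) : Prop := GradedIdeal {
  gi_homog : forall d F, J d F -> F \is d.-homog;
  gi0 : forall d, J d 0;
  giD : forall d F G, J d F -> J d G -> J d (F + G);
  giM : forall d e F G, J d F -> G \is e.-homog -> J (e + d)%N (G * F)
}.

(** The ideal does not contain a power of the irrelevant ideal. *)
Definition gi_proper (J : nat -> {mpoly L[n]} -> Prop) :=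
  forall N, exists2 F, F \is N.-homog & ~ J N F.

Section Ideals.
Variable J : nat -> {mpoly L[n]} -> Prop.
Hypothesis iJ : graded_ideal J.

Lemma giZ d c F : J d F -> J d (c *: F).
Proof.
move=> JF; rewrite -mul_mpolyC -[d]add0n; apply: giM => //.
by rewrite -[c%:MP]mulr1 mul_mpolyC; apply: rpredZ; apply: dhomog1.
Qed.

Lemma giB d F G : J d F -> J d G -> J d (F - G).
Proof. by move=> JF JG; apply: giD => //; rewrite -scaleN1r; apply: giZ. Qed.

Lemma gi_sum d (I : Type) (r : seq I) (P : pred I) (F : I -> {mpoly L[n]}) :
  (forall i, P i -> J d (F i)) -> J d (\sum_(i <- r | P i) F i).
Proof. by move=> JF; apply: big_rec => [|i x Pi Jx]; [exact: gi0 | apply: giD => //; exact: JF]. Qed.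

Lemma gi_full_up N k : (forall F, F \is N.-homog -> J N F) -> (N <= k)%N ->
  forall F, F \is k.-homog -> J k F.
Proof.
move=> full; elim: k => [|k IH]; first by rewrite leqn0 => /eqP N0; subst N.
rewrite leq_eqVlt => /orP[/eqP e|Nk] F hF; first by subst N; apply: full.
have [G hG ->] := homogS_sum hF; apply: gi_sum => j _.
by rewrite -[k.+1]add1n; apply: giM; rewrite ?homogX //; apply: IH.
Qed.

(** The ideal J + (F), with dF the degree of F. The condition on B when d < dF
    excludes the constants that truncated subtraction would let in. *)
Definition gi_add dF F d H : Prop := exists A B : {mpoly L[n]},
  [/\ J d A, B \is (d - dF)%N.-homog, (d < dF)%N -> B = 0 & H = A + B * F].

Lemma gi_addP dF F : F \is dF.-homog -> graded_ideal (gi_add dF F).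
Proof.
move=> hF; split.
- move=> d _ [A [B [JA hB B0 ->]]]; apply: rpredD; first exact: gi_homog JA.
  case: (ltnP d dF) => [/B0->|dFd]; first by rewrite mul0r; exact: dhomog0.
  by rewrite -(subnK dFd) dhomogM.
- by move=> d; exists 0, 0; split=> //; [exact: gi0 | exact: dhomog0 | rewrite mul0r addr0].
- move=> d _ _ [A [B [JA hB B0 ->]]] [A' [B' [JA' hB' B0' ->]]].
  exists (A + A'), (B + B'); split; [exact: giD | exact: rpredD | |].
    by move=> lt; rewrite B0 // B0' // addr0.
  by rewrite mulrDl addrACA.
move=> d e _ G [A [B [JA hB B0 ->]]] hG.
case: (ltnP d dF) => [lt|dFd].
  rewrite B0 // mul0r addr0; exists (G * A), 0; split=> //; first exact: giM.
    exact: dhomog0.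
  by rewrite mul0r addr0.
exists (G * A), (G * B); split; [exact: giM | | |].
- by rewrite -addnBA // dhomogM.
- by rewrite ltnNge (leq_trans dFd) ?leq_addl.
by rewrite mulrDr mulrA.
Qed.

(** The ideal quotient J : F, with dF the degree of F. *)
Definition gi_colon dF F d H : Prop := H \is d.-homog /\ J (d + dF)%N (H * F).

Lemma gi_colonP dF F : graded_ideal (gi_colon dF F).
Proof.
split.
- by move=> d H [].
- by move=> d; split; [exact: dhomog0 | rewrite mul0r; exact: gi0].
- by move=> d A B [hA JA] [hB JB]; split; [exact: rpredD | rewrite mulrDl; exact: giD].
by move=> d e A B [hA JA] hB; split; [exact: dhomogM | rewrite -mulrA -addnA; apply: giM].
Qed.

End Ideals.

End Homogeneous.

(** * The projective Nullstellensatz *)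

Section FormsAsSpace.
Variables (L : fieldType) (n : nat) (d : nat).
Implicit Types F : {mpoly L[n.+1]}.

Lemma formP F : F \is d.-homog -> exists f : Defs.form L n d, F = f :> {mpoly L[n.+1]}.
Proof. by move=> hF; exists (DHomog hF). Qed.

Lemma form_homog (f : Defs.form L n d) : (f : {mpoly L[n.+1]}) \is d.-homog.
Proof. exact: dhomog_is_dhomog. Qed.

Lemma formZD c (f g : Defs.form L n d) :
  (c *: f + g : Defs.form L n d) = c *: (f : {mpoly L[n.+1]}) + (g : {mpoly L[n.+1]}) :> {mpoly L[n.+1]}.
Proof. by []. Qed.

Lemma form0 : (0 : Defs.form L n d) = 0 :> {mpoly L[n.+1]}.
Proof. by []. Qed.
End FormsAsSpace.

Section Nullstellensatz.

Variables (L : closedFieldType) (w : nat).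
Local Notation P := {mpoly L[w.+1]}.
Implicit Types (F G H : P) (J M : nat -> P -> Prop).

Lemma vspace_of_graded_ideal J d : graded_ideal J ->
  exists U : {vspace Defs.form L w d}, forall f : Defs.form L w d, f \in U <-> J d f.
Proof.
move=> iJ; apply: (vspace_of_pred (P := fun f : Defs.form L w d => J d f)).
  by rewrite form0; apply: gi0.
by move=> a f g Jf Jg; rewrite formZD; apply: giD => //; apply: giZ.
Qed.

(** Zorn's lemma applies because the space of forms of degree N is finite
    dimensional: a union of a chain of ideals that contains all forms of degree N
    has a member containing a basis of them. *)
Lemma graded_ideal_maximal J : graded_ideal J -> gi_proper J ->
  exists M, [/\ graded_ideal M, gi_proper M, (forall d F, J d F -> M d F) &
    forall M', graded_ideal M' -> gi_proper M' ->
      (forall d F, M d F -> M' d F) -> forall d F, M' d F -> M d F].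
Proof.
move=> iJ pJ.
pose T := {M : nat -> P -> Prop | [/\ graded_ideal M, gi_proper M
                                   & forall d F, J d F -> M d F]}.
pose R (s t : T) := `[< forall d F, sval s d F -> sval t d F >].
have t0 : T by exists J.
have [|r s t|A Atot|[M [iM pM JM]] Mmax] := @classical_sets.ZL_preorder T t0 R.
- by move=> t; apply/asboolP.
- by move=> /asboolP rs /asboolP st; apply/asboolP => d F /rs /st.
- have [[s0 As0]|nA] := EM (exists s, A s); last first.
    by exists t0 => s As; case: nA; exists s.
  pose U d F := exists2 s, A s & sval s d F.
  have iU : graded_ideal U.
    split.
    + by move=> d F [[M [iM ? ?]] _ /=]; apply: gi_homog.
    + by move=> d; exists s0 => //; case: (s0) => M [iM ? ?]; apply: gi0.
    + move=> d F G [s As sF] [t At tG]; have [/asboolP st|/asboolP ts] := Atot s t As At.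
        exists t => //; move: (st _ _ sF) tG; case: (t) => M [iM ? ?] /=; exact: giD.
      exists s => //; move: (ts _ _ tG) sF; case: (s) => M [iM ? ?] /= MG MF; exact: giD.
    move=> d e F G [s As sF] hG; exists s => //.
    by move: sF; case: (s) => M [iM ? ?] /= MF; apply: giM.
  have pU : gi_proper U.
    move=> N; apply: contrapT => full.
    have {}full F : F \is N.-homog -> U N F.
      by move=> hF; apply: contrapT => nU; apply: full; exists F.
    have [s As sb] : exists2 s, A s & forall f : Defs.form L w N,
        f \in (vbasis {:Defs.form L w N} : seq _) -> sval s N f.
      elim: (vbasis _ : seq _) => [|f r [s As sr]]; first by exists s0.
      have [t At tf] := full _ (form_homog f).
      have [/asboolP st|/asboolP ts] := Atot s t As At.
        by exists t => // g; rewrite inE => /orP[/eqP->|/sr/st].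
      by exists s => // g; rewrite inE => /orP[/eqP->|/sr//]; apply: ts.
    case: s As sb => M [iM pM JM] /= _ sb.
    have [F /formP[f ->]] := pM N; apply.
    have [V VP] := vspace_of_graded_ideal N iM; apply/VP.
    suff /subvP sub : (fullv <= V)%VS by apply: sub; exact: memvf.
    rewrite -(span_basis (vbasisP fullv)); apply/span_subvP => g gb.
    by apply/VP; exact: sb.
  have JU d F : J d F -> U d F.
    by move=> JF; exists s0 => //; case: (s0) => M [_ _ /=]; apply.
  exists (exist _ U (And3 iU pU JU)) => s As; apply/asboolP => d F sF.
  by exists s.
exists M; split=> // M' iM' pM' MM'.
have JM' d F : J d F -> M' d F by move/JM/MM'.
have /(_ _)/asboolP := Mmax (exist _ M' (And3 iM' pM' JM')); apply.
by apply/asboolP.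
Qed.

Section Maximal.

Variable M : nat -> P -> Prop.
Hypotheses (iM : graded_ideal M) (pM : gi_proper M).
Hypothesis maxM : forall M', graded_ideal M' -> gi_proper M' ->
  (forall d F, M d F -> M' d F) -> forall d F, M' d F -> M d F.

(** By maximality an ideal strictly larger than M contains all forms of large degree. *)
Lemma maximal_full J d F : graded_ideal J -> (forall e G, M e G -> J e G) ->
  J d F -> ~ M d F -> exists N, forall k G, (N <= k)%N -> G \is k.-homog -> J k G.
Proof.
move=> iJ MJ JF nMF.
have [pJ|npJ] := EM (gi_proper J); first by case: nMF; apply: maxM JF.
have [N full] : exists N, forall F, F \is N.-homog -> J N F.
  apply: contrapT => nfull; apply: npJ => N; apply: contrapT => nN; apply: nfull.
  by exists N => G hG; apply: contrapT => nG; apply: nN; exists G.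
by exists N => k G Nk hG; apply: gi_full_up Nk _ hG.
Qed.

Lemma maximal_add d F : F \is d.-homog -> ~ M d F ->
  exists N, forall k G, (N <= k)%N -> G \is k.-homog -> gi_add M d F k G.
Proof.
move=> hF nMF; apply: (maximal_full (d := d) (F := F)) => //.
- exact: gi_addP.
- move=> e G MG; exists G, 0; split=> //; first exact: dhomog0.
  by rewrite mul0r addr0.
exists 0, 1; split; [exact: gi0 | by rewrite subnn dhomog1 | by rewrite ltnn |].
by rewrite mul1r add0r.
Qed.

(** If F is not in M but FG is, then M + (F) and, if G is not in M either, M : F
    contain all forms of large degree; so M contains all forms A + BF of large
    degree, against its properness. *)
Lemma maximal_prime d e F G : F \is d.-homog -> G \is e.-homog ->
  M (e + d)%N (G * F) -> M d F \/ M e G.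
Proof.
move=> hF hG MGF; apply: contrapT => /not_orP[nF nG].
have [N fullN] := maximal_add hF nF.
have [N' fullN'] : exists N', forall k H, (N' <= k)%N -> H \is k.-homog -> gi_colon M d F k H.
  apply: (maximal_full (d := e) (F := G)) => //; first exact: gi_colonP.
  by move=> k H MH; split; [exact: gi_homog MH | rewrite addnC mulrC; exact: giM].
have [H hH nH] := pM (N + N' + d)%N; apply: nH.
have [|A [B [MA hB B0 ->]]] := fullN (N + N' + d)%N H _ hH.
  by rewrite -addnA leq_addr.
apply: giD => //; rewrite addnK in hB.
by have [|_] := fullN' (N + N')%N B _ hB; rewrite ?leq_addl.
Qed.

Lemma maximal_var : exists i, ~ M 1%N 'X_i.
Proof.
apply: contrapT => all; have [F hF] := pM 1%N; apply.
have [G hG ->] := homogS_sum hF; apply: (gi_sum iM) => j _.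
rewrite mulrC -[1%N]add0n; apply: giM => //.
by apply: contrapT => nX; apply: all; exists j.
Qed.

(** Since 'X_i is not in M, in some degree N + 1 every form is a multiple of 'X_i
    modulo M. Division of 'X_j v by 'X_i is then an endomorphism of the forms of
    degree N modulo M, and an eigenvector v with eigenvalue a satisfies
    ('X_j - a 'X_i) v in M. Primality removes v. *)
Lemma maximal_proportional i j : ~ M 1%N 'X_i -> exists a, M 1%N ('X_j - a *: 'X_i).
Proof.
move=> nXi; have [N fullN] := maximal_add (homogX _ _) nXi.
have [U UP] := vspace_of_graded_ideal N iM.
pose rho (v v' : Defs.form L w N) := M N.+1 ('X_j * (v : P) - 'X_i * (v' : P)).
have [||v||a [v [u [vU uU]]]] := @rel_eigenvector L _ U rho.
- by rewrite /rho form0 !mulr0 subr0; apply: gi0.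
- move=> a v v' w1 w' r r'; rewrite /rho !formZD !mulrDr -!scalerAr opprD addrACA -scalerBr.
  by apply: giD => //; apply: giZ.
- have [|A [B [MA hB _ E]]] := fullN N.+1 ('X_j * (v : P)) (leqnSn _).
    exact: (dhomogM (homogX _ _) (form_homog v)).
  rewrite subn1 /= in hB; have [b Eb] := formP hB.
  by exists b; rewrite /rho E -Eb ['X_i * _]mulrC addrK.
- apply/eqP => U1; have [F hF nF] := pM N; apply: nF.
  by have [f ->] := formP hF; apply/UP; rewrite U1 memvf.
rewrite /rho formZD => Mv; exists a.
have : M N.+1 (('X_j - a *: 'X_i) * (v : P)).
  move: Mv; rewrite mulrBl mulrDr -scalerAr opprD addrA -scalerAl => Mv.
  rewrite -[_ - _](subrK ('X_i * (u : P))); apply: giD => //.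
  by rewrite -[N.+1]add1n; apply: giM; rewrite ?homogX //; apply/UP.
case/(@maximal_prime N 1%N) => //; first exact: form_homog.
  by apply: rpredB; [|apply: rpredZ]; apply: homogX.
by move/UP; rewrite (negPf vU).
Qed.

(** Since 'X_j is a_j 'X_i modulo M, a form F in M is F(a) 'X_i^d modulo M, and no
    power of 'X_i is in M. *)
Lemma maximal_point : exists i (a : 'I_w.+1 -> L), a i = 1 /\
  forall d F, M d F -> F.@[a] = 0.
Proof.
have [i nXi] := maximal_var; exists i.
have [a aP] := choice (fun j => maximal_proportional j nXi).
exists a; have ai : a i = 1.
  apply: contrapT => /eqP ai; apply: nXi.
  have := giZ iM (1 - a i)^-1 (aP i).
  by rewrite -{1}['X_i]scale1r -scalerBl scalerA mulVf ?scale1r // subr_eq0 eq_sym.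
split=> // d F MF; apply: contrapT => /eqP Fa.
have nXn k : ~ M k ('X_i ^+ k).
  elim: k => [|k IH].
    rewrite expr0 => M1; have [G hG] := pM 0%N; apply.
    by rewrite -[G]mulr1 -[0%N]addn0; apply: giM.
  by rewrite exprS => /(@maximal_prime k 1%N)[] //; [exact: homogXn | exact: homogX].
suff : M d (F.@[a] *: 'X_i ^+ d).
  by move/(giZ iM (F.@[a])^-1); rewrite scalerA mulVf // scale1r => /nXn.
have hF := gi_homog iM MF; case: d MF hF => [|d] MF hF.
  by rewrite expr0 -mul_mpolyC mulr1 -(homog0_meval a hF).
have [G hG E] := homog_taylor ai hF.
have -> : F.@[a] *: 'X_i ^+ d.+1 = F - \sum_j shift a i j * G j.
  by rewrite {2}E addrK.
apply: (giB iM) => //; apply: (gi_sum iM) => j _.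
rewrite mulrC -[d.+1]addn1; exact: (giM iM (aP j) (hG j)).
Qed.

End Maximal.

Lemma ppoint_of_vector (a : 'I_w.+1 -> L) i : a i != 0 ->
  exists (p : ppoint L w) c, p =1 (fun j => c * a j).
Proof.
move=> ai; case: (@arg_minnP _ i (fun i => a i != 0) (fun i => i : nat) ai) => k ak kmin.
pose x : {ffun 'I_w.+1 -> L} := [ffun j => (a k)^-1 * a j].
have nx : normalised x.
  apply/existsP; exists k; rewrite ffunE mulVf // eqxx /=.
  apply/forallP => j; apply/implyP => jk; rewrite ffunE.
  have [->|/kmin] := eqVneq (a j) 0; first by rewrite mulr0.
  by rewrite leqNgt jk.
by exists (PPoint nx), (a k)^-1 => j /=; rewrite ffunE.
Qed.

(** A maximal proper homogeneous ideal contains a linear form 'X_j - a_j 'X_i for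
    each j, and is therefore the ideal of the point a. *)
Theorem projective_nullstellensatz J : graded_ideal J -> gi_proper J ->
  exists p : ppoint L w, forall d F, J d F -> F.@[p] = 0.
Proof.
move=> iJ pJ; have [M [iM pM JM maxM]] := graded_ideal_maximal iJ pJ.
have [i [a [ai aP]]] := maximal_point iM pM maxM.
have [|p [c pE]] := @ppoint_of_vector a i; first by rewrite ai oner_neq0.
exists p => d F JF.
rewrite (meval_eq _ pE) (meval_homogZ _ _ (gi_homog iJ JF)) (aP d) ?mulr0 //.
exact: JM.
Qed.

End Nullstellensatz.

(** * Forms restricted to an irreducible curve *)

Notation ev F q := (meval (pcoord (val q)) F).

Section Curve.

Variables (L : closedFieldType) (w : nat) (C : curve L w).
Local Notation P := {mpoly L[w.+1]}.
Local Notation pt := {p : ppoint L w | p \in curve_set C}.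
Implicit Types (F G H : P) (p q : pt) (Z : {pred ppoint L w}).

Definition van F := forall q, ev F q = 0.

Lemma vanP d (f : Defs.form L w d) : vanishes_on C f <-> van f.
Proof.
by split=> [vf q|vf p pC]; [exact: vf (valP q) | exact: (vf (exist _ p pC))].
Qed.

Lemma zclosed_zeros d F : F \is d.-homog -> zclosed [pred p | F.@[pcoord p] == 0].
Proof.
move=> hF; exists (fun e G => (G : P) = F) => p; rewrite inE; split.
  by move=> /eqP Fp e G EG; rewrite /feval EG.
by move=> /(_ d (DHomog hF)) /= Fp; apply/eqP/Fp.
Qed.

(** The products of an equation of Z1 and an equation of Z2 define the union. *)
Lemma zclosedU Z1 Z2 : zclosed Z1 -> zclosed Z2 -> zclosed [predU Z1 & Z2].
Proof.
move=> [T1 Z1P] [T2 Z2P].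
exists (fun d F => exists d1 d2 (F1 : Defs.form L w d1) (F2 : Defs.form L w d2),
  [/\ T1 d1 F1, T2 d2 F2 & (F : P) = (F1 : P) * (F2 : P)]) => p; rewrite inE; split.
  move=> /orP[/Z1P|/Z2P] pZ d F [d1 [d2 [F1 [F2 [T1F T2F EF]]]]]; rewrite /feval EF mevalM.
    by have := pZ _ _ T1F; rewrite /feval => ->; rewrite mul0r.
  by have := pZ _ _ T2F; rewrite /feval => ->; rewrite mulr0.
move=> all; apply/orP; have [|n1] := EM (p \in Z1); first by left.
right; apply/Z2P => d2 F2 T2F; apply: contrapT => /eqP F2p; apply: n1.
apply/Z1P => d1 F1 T1F; apply/eqP.
have hF := dhomogM (form_homog F1) (form_homog F2).
have /= := all _ (DHomog hF); rewrite /feval /= mevalM => all'.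
have /eqP := all' (ex_intro _ d1 (ex_intro _ d2 (ex_intro _ F1 (ex_intro _ F2 (And3 T1F T2F erefl))))).
by rewrite mulf_eq0 (negPf F2p) orbF.
Qed.

(** Complements of these sets are the non-empty open subsets of C on which identities
    between functions are tested. *)
Definition proper_closed Z := zclosed Z /\ ~ {subset C <= Z}.

Lemma proper_closedU Z1 Z2 :
  proper_closed Z1 -> proper_closed Z2 -> proper_closed [predU Z1 & Z2].
Proof.
move=> [c1 p1] [c2 p2]; split; first exact: zclosedU.
by case: (curve_irreducible C) => _ irr /(irr _ _ c1 c2)[].
Qed.

Lemma proper_closed_zeros d F : F \is d.-homog -> ~ van F ->
  proper_closed [pred p | F.@[pcoord p] == 0].
Proof.
move=> hF nF; split; first exact: zclosed_zeros hF.
by move=> sub; apply: nF => q; apply/eqP; have := sub _ (valP q); rewrite inE.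
Qed.

Lemma proper_closed0 : proper_closed pred0.
Proof.
split; last by case: (curve_irreducible C) => -[p pC] _ /(_ p pC).
have [T TP] := zclosed_zeros (dhomog1 (n := w.+1) L mdeg).
by exists T => p; rewrite -TP !inE meval1 oner_eq0.
Qed.

Lemma proper_closed_bigU (I : finType) (Z : I -> {pred ppoint L w}) :
  (forall i, proper_closed (Z i)) ->
  exists2 U : {pred ppoint L w}, proper_closed U & forall i, {subset Z i <= U}.
Proof.
move=> ZP; suff [U UP ZU] : exists2 U : {pred ppoint L w}, proper_closed U &
   forall i, i \in enum I -> {subset Z i <= U}.
  by exists U => // i; apply: ZU; rewrite mem_enum.
elim: (enum I) => [|i r [U UP rU]]; first by exists (pred0 : pred (ppoint L w)) => //; exact: proper_closed0.
exists ([predU (Z i) & U] : pred _); first exact: proper_closedU.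
move=> j; rewrite inE => /orP[/eqP-> p|/rU jU p /jU pU]; rewrite inE; first by move=> ->.
by apply/orP; right.
Qed.

(** By irreducibility, C is covered by Z and the zeros of F only if F vanishes on C. *)
Lemma generic_van Z d F : proper_closed Z -> F \is d.-homog ->
  (forall q, val q \notin Z -> ev F q = 0) -> van F.
Proof.
move=> [cZ pZ] hF FZ; case: (curve_irreducible C) => _ irr.
have [|//|sub q] := irr Z [pred p | F.@[pcoord p] == 0] cZ (zclosed_zeros hF).
  move=> p pC; rewrite inE; case: (boolP (p \in Z)) => //= pnZ.
  by apply/eqP; exact: (FZ (exist _ p pC)).
by apply/eqP; have := sub _ (valP q); rewrite inE.
Qed.

Lemma generic_eq Z d F G : proper_closed Z -> F \is d.-homog -> G \is d.-homog ->
  (forall q, val q \notin Z -> ev F q = ev G q) -> forall q, ev F q = ev G q.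
Proof.
move=> pZ hF hG FG q; apply/eqP; rewrite -subr_eq0 -mevalB; apply/eqP.
move: q; apply: (generic_van (d := d) pZ); first exact: rpredB.
by move=> q qZ; rewrite mevalB FG // subrr.
Qed.

Lemma van_mul d e F G : F \is d.-homog -> G \is e.-homog ->
  van (F * G) -> van F \/ van G.
Proof.
move=> hF hG vFG; apply: contrapT => /not_orP[nF nG]; apply: nG.
apply: (generic_van (proper_closed_zeros hF nF) hG) => q; rewrite inE => Fq.
by have /eqP := vFG q; rewrite mevalM mulf_eq0 (negPf Fq) => /eqP.
Qed.

Lemma nonvan_mul d e F G : F \is d.-homog -> G \is e.-homog ->
  ~ van F -> ~ van G -> ~ van (F * G).
Proof. by move=> hF hG nF nG /(van_mul hF hG)[]. Qed.

Lemma nonvan_exp d F n : F \is d.-homog -> ~ van F -> ~ van (F ^+ n).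
Proof.
move=> hF nF; elim: n => [|n IH].
  move=> v1; case: (curve_irreducible C) => -[p pC] _.
  by have /eqP := v1 (exist _ p pC); rewrite meval1 oner_eq0.
by rewrite exprS; apply: nonvan_mul hF (homog_exp n hF) nF IH.
Qed.

Lemma ev_cancel d e F G T : F \is d.-homog -> G \is d.-homog -> T \is e.-homog ->
  ~ van T -> (forall q, ev F q * ev T q = ev G q * ev T q) ->
  forall q, ev F q = ev G q.
Proof.
move=> hF hG hT nT FGT; apply: (generic_eq (proper_closed_zeros hT nT) hF hG).
by move=> q; rewrite inE => Tq; apply: (mulIf Tq); apply: FGT.
Qed.

Lemma coord_unit (p : ppoint L w) : exists i, pcoord p i = 1.
Proof. by case: p => x /= /existsP[i /andP[/eqP xi _]]; exists i. Qed.

(** On a finite set every function takes finitely many values, so it is a root of a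
    polynomial; this contradicts transcendence. *)
Lemma curve_infinite (s : seq (ppoint L w)) : exists q, val q \notin s.
Proof.
apply: contrapT => nq; have [t [tr _]] := curve_dim C.
pose R := \prod_(y <- [seq t x | x <- s]) ('X - y%:P).
suff /eqP : R = 0 by apply/negP; rewrite monic_neq0 // monic_prod_XsubC.
apply: tr; exists (pred0 : pred (ppoint L w)); have [? ?] := proper_closed0; split=> // p pC _.
have ps : p \in s by apply: contrapT => /negP ps; apply: nq; exists (exist _ p pC).
by apply/eqP; rewrite -[_ == 0]/(root R (t p)) root_prod_XsubC map_f.
Qed.

Lemma curve_two_points p : exists q, q != p.
Proof.
have [q] := curve_infinite [:: val p]; rewrite inE => qp.
by exists q; apply: contra qp => /eqP ->.
Qed.

Lemma nonvan_var : exists i, ~ van 'X_i.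
Proof.
case: (curve_irreducible C) => -[p pC] _; have [i pi] := coord_unit p.
exists i => /(_ (exist _ p pC)) /eqP; by rewrite mevalXU /= pi oner_eq0.
Qed.

End Curve.

(** * Linear growth of the Hilbert function *)

Section PolynomialRelations.
Variable L : fieldType.

Lemma horner_horner_coef n (S : {poly {poly L}}) (y z : L) : (size S <= n)%N ->
  S.[y%:P].[z] = \sum_(i < n) (S`_i).[z] * y ^+ i.
Proof.
move=> Sn; rewrite (horner_coef_wide _ Sn) horner_sum; apply: eq_bigr => i _.
by rewrite hornerM horner_exp hornerC.
Qed.

(** The leading coefficient a of Q is the only denominator needed to express the
    power y^n through lower ones. *)
Lemma monic_relation (Q : {poly {poly L}}) : Q != 0 ->
  exists n (a : {poly L}) (S : {poly {poly L}}), [/\ a != 0, (size S <= n)%N &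
    forall y z, Q.[y%:P].[z] = 0 -> a.[z] * y ^+ n = S.[y%:P].[z]].
Proof.
move=> Q0; pose n := (size Q).-1.
exists n, (lead_coef Q), (- \poly_(i < n) Q`_i).
rewrite lead_coef_eq0 size_polyN size_poly; split=> // y z.
have sQ : (size Q <= n.+1)%N by rewrite /n leqSpred.
rewrite (horner_horner_coef _ _ sQ) big_ord_recr /= -/n => /eqP.
rewrite addrC addr_eq0 => /eqP ->; rewrite hornerN hornerN; congr (- _).
rewrite (@horner_horner_coef n) ?size_poly //; apply: eq_bigr => i _.
by rewrite coef_poly ltn_ord.
Qed.

End PolynomialRelations.

Section BoundedCombinations.

Variables (L : fieldType) (T : Type) (U : T -> Prop) (m n : nat).
Variables (t : T -> L) (f : 'I_m -> T -> L).
Local Notation box := {ffun 'I_m -> 'I_n}.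

(** Monomials in the functions f_j whose exponents are all smaller than n. *)
Definition boxmon (b : box) q := \prod_j f j q ^+ b j.

(** The span over L of the functions t^k f^b with k < M and f^b a monomial of the
    box: a space of dimension at most M n^m, linear in M. *)
Definition bounded_comb M (phi : T -> L) := exists2 c : box -> {poly L},
  forall b, (size (c b) <= M)%N &
  forall q, U q -> phi q = \sum_b (c b).[t q] * boxmon b q.

Lemma bounded_comb_ext M phi psi : bounded_comb M phi ->
  (forall q, U q -> psi q = phi q) -> bounded_comb M psi.
Proof. by move=> [c cM E] e; exists c => // q Uq; rewrite e // E. Qed.

Lemma bounded_comb_sum M (I : finType) (phi : I -> T -> L) :
  (forall i, bounded_comb M (phi i)) -> bounded_comb M (fun q => \sum_i phi i q).
Proof.
move=> W; pose c i := s2val (cid2 (W i)).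
have cP i : (forall b, (size (c i b) <= M)%N) /\
   forall q, U q -> phi i q = \sum_b (c i b).[t q] * boxmon b q.
  by rewrite /c; case: cid2.
exists (fun b => \sum_i c i b) => [b|q Uq].
  by apply: (leq_trans (size_sum _ _ _)); apply/bigmax_leqP => i _; case: (cP i).
rewrite (eq_bigr _ (fun i _ => proj2 (cP i) q Uq)) exchange_big.
by apply: eq_bigr => b _; rewrite horner_sum mulr_suml.
Qed.

Lemma bounded_comb1 M (r : {poly L}) b : (size r <= M)%N ->
  bounded_comb M (fun q => r.[t q] * boxmon b q).
Proof.
move=> rM; exists (fun b' => if b' == b then r else 0) => [b'|q _].
  by case: eqP => // _; rewrite size_poly0.
rewrite (bigD1 b) //= eqxx big1 ?addr0 // => b' /negPf ->.
by rewrite horner0 mul0r.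
Qed.

Variables (a : {poly L}) (S : 'I_m -> 'I_n -> {poly {poly L}}).
Hypothesis Ssize : forall j i, (size (S j i) <= n)%N.
Hypothesis SP : forall j (i : 'I_n) q, U q ->
  a.[t q] * f j q ^+ i.+1 = (S j i).[(f j q)%:P].[t q].

(** Multiplying f^b by f_j may push the j-th exponent out of the box; the
    relation for a(t) f_j^(i+1) brings it back, at the cost of a bounded increase c
    of the degrees in t. *)
Lemma bounded_comb_step : exists c, forall M phi j, bounded_comb M phi ->
  bounded_comb (c + M)%N (fun q => a.[t q] * f j q * phi q).
Proof.
pose sz (u : 'I_m * ('I_n * 'I_n)) := size (S u.1 u.2.1)`_u.2.2.
exists (\max_u sz u)%N => M phi j [c cM E].
pose upd (b : {ffun 'I_m -> 'I_n}) i : {ffun 'I_m -> 'I_n} :=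
  [ffun k => if k == j then i else b k].
pose term b (i : 'I_n) q := (c b * (S j (b j))`_i).[t q] * boxmon (upd b i) q.
apply: (@bounded_comb_ext _ (fun q => \sum_b \sum_i term b i q)).
  apply: bounded_comb_sum => b; apply: bounded_comb_sum => i; apply: bounded_comb1.
  have [->|c0] := eqVneq (c b) 0; first by rewrite mul0r size_poly0.
  have [->|s0] := eqVneq (S j (b j))`_i 0; first by rewrite mulr0 size_poly0.
  rewrite size_mul // addnC; apply: (leq_trans (leq_pred _)); apply: leq_add; last exact: cM.
  exact: (@leq_bigmax _ _ (j, (b j, i))).
move=> q Uq; rewrite E // mulr_sumr; apply: eq_bigr => b _.
rewrite {1}/boxmon (bigD1 j) //=.
set R := \prod_(_ | _) _.
transitivity ((c b).[t q] * (a.[t q] * f j q ^+ (b j).+1) * R); first by rewrite exprS; ring.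
rewrite SP // (horner_horner_coef _ _ (Ssize _ _)) mulr_sumr mulr_suml.
apply: eq_bigr => i _; rewrite /term hornerM /boxmon (bigD1 j) //= ffunE eqxx -!mulrA.
congr (_ * (_ * (_ * _))); apply: eq_bigr => k kj; by rewrite ffunE (negPf kj).
Qed.

End BoundedCombinations.

Section Growth.

Variables (L : closedFieldType) (w : nat) (C : curve L w).
Local Notation P := {mpoly L[w.+1]}.
Local Notation pt := {p : ppoint L w | p \in curve_set C}.
Implicit Types (F G H : P) (p q : pt) (Z : {pred ppoint L w}).

(** Homogenisation of a: the form is D^k a(N/D) for t = N/D. It does not vanish on C
    because t is transcendental. *)
Lemma transcendental_form (t : ratfun C) :
  (forall R : {poly L}, eq_gen C (fun x => R.[t x]) (fun=> 0) -> R = 0) ->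
  forall a : {poly L}, a != 0 -> exists d F, [/\ F \is d.-homog, ~ van C F &
    forall q, feval (rden t) (val q) != 0 -> a.[t (val q)] = 0 -> ev F q = 0].
Proof.
move=> tr a a0; have hN := form_homog (rnum t); have hD := form_homog (rden t).
have nD : ~ van C (rden t) by move/vanP; case: (t).
set N : P := rnum t in hN *; set D : P := rden t in hD nD *; set d := rdeg t in hN hD *.
pose F := \sum_(i < size a) a`_i *: (N ^+ i * D ^+ (size a - i)).
have FE q : ev D q != 0 -> ev F q = ev D q ^+ size a * a.[t (val q)].
  move=> Dq; rewrite horner_coef mulr_sumr raddf_sum; apply: eq_bigr => i _ /=.
  rewrite mevalZ mevalM !rmorphXn /= /rval /feval exprMn exprVn -/N -/D.
  have -> : ev D q ^+ size a = ev D q ^+ (size a - i) * ev D q ^+ i.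
    by rewrite -exprD subnK // ltnW.
  by move: (expf_neq0 i Dq) => ?; set y := _ ^+ i; field.
exists (d * size a)%N, F; split.
- apply: rpred_sum => i _; apply: rpredZ.
  have -> : (d * size a = d * i + d * (size a - i))%N by rewrite -mulnDr subnKC // ltnW.
  by apply: dhomogM; apply: homog_exp.
- move=> vF; case/eqP: a0; apply: tr.
  have [cZ pZ] := proper_closed_zeros hD nD.
  exists ([pred p | D.@[pcoord p] == 0] : pred _); split=> // p pC; rewrite inE => Dp.
  have /eqP := FE (exist _ p pC) Dp; rewrite vF eq_sym mulf_eq0 expf_eq0 /= (negPf Dp) andbF.
  by move/eqP.
by move=> q Dq aq; rewrite FE // aq mulr0.
Qed.

(** A common leading coefficient a and a common exponent n + 1 for the relations
    satisfied by all the f_j over L(t); S j i expresses a(t) f_j^(i+1) through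
    f_j^0, ..., f_j^n. *)
Lemma algebraic_relations (t : ratfun C) (f : 'I_w.+1 -> ratfun C) :
  (forall f : ratfun C, exists2 Q : {poly {poly L}},
       Q != 0 & eq_gen C (fun x => Q.[(f x)%:P].[t x]) (fun=> 0)) ->
  exists n (a : {poly L}) (S : 'I_w.+1 -> 'I_n.+1 -> {poly {poly L}}) Z,
  [/\ a != 0, proper_closed C Z, forall j i, (size (S j i) <= n.+1)%N &
   forall j (i : 'I_n.+1) q, val q \notin Z ->
    a.[t (val q)] * f j (val q) ^+ i.+1 = (S j i).[(f j (val q))%:P].[t (val q)]].
Proof.
move=> alg.
have rel j : exists v : nat * {poly L} * {poly {poly L}} * {pred ppoint L w},
  [/\ v.1.1.2 != 0, (size v.1.2 <= v.1.1.1)%N, proper_closed C v.2 &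
   forall q, val q \notin v.2 ->
    v.1.1.2.[t (val q)] * f j (val q) ^+ v.1.1.1 = v.1.2.[(f j (val q))%:P].[t (val q)]].
  have [Q Q0 [Z [cZ pZ QZ]]] := alg (f j).
  have [n [a [S [a0 Sn SP]]]] := monic_relation Q0.
  exists (n, a, S, Z); split=> // q qZ; apply: SP; apply: QZ => //; exact: valP.
have [v vP] := choice rel.
have [Z pZ subZ] : exists2 Z : {pred ppoint L w}, proper_closed C Z &
    forall j, {subset (v j).2 <= Z}.
  by apply: proper_closed_bigU => j; case: (vP j).
pose n := (\max_j (v j).1.1.1)%N; pose a := \prod_j (v j).1.1.2.
have nj j : ((v j).1.1.1 <= n)%N by exact: (@leq_bigmax _ (fun j => (v j).1.1.1) j).
(* below the top exponent nothing has to be reduced; at the top the relation of f_j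
   is multiplied by the leading coefficients of the others *)
pose S (j : 'I_w.+1) (i : 'I_n.+1) : {poly {poly L}} :=
  if (i < n)%N then a *: 'X^(i.+1)
  else (\prod_(k | k != j) (v k).1.1.2) *: ((v j).1.2 * 'X^(n.+1 - (v j).1.1.1)).
exists n, a, S, Z; split=> //.
- by apply/prodf_neq0 => j _; case: (vP j).
- move=> j i; rewrite /S; case: ltnP => [ni|_].
    by apply: (leq_trans (size_scale_leq _ _)); rewrite size_polyXn.
  apply: (leq_trans (size_scale_leq _ _)); have [_ sS _ _] := vP j.
  apply: (leq_trans (size_polyMleq _ _)); rewrite size_polyXn addnS /=.
  by apply: (leq_trans (leq_add sS (leqnn _))); rewrite subnKC // ltnW // ltnS.
move=> j i q qZ; rewrite /S; case: ltnP => [_|ni].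
  by rewrite hornerZ hornerXn hornerM horner_exp hornerC.
have ei : i = n :> nat by apply/anti_leq; rewrite ni -ltnS ltn_ord.
have [_ _ _ /(_ q) E] := vP j.
rewrite hornerZ !hornerM hornerXn horner_exp hornerC -E; last first.
  by apply: contra qZ; apply: subZ.
rewrite /a (bigD1 j) //= hornerM ei -{1}(@subnK (v j).1.1.1 n.+1) ?leqW //.
by rewrite exprD; ring.
Qed.

Lemma exists_van_space N : exists I : {vspace Defs.form L w N},
  forall f : Defs.form L w N, f \in I <-> van C f.
Proof.
apply: (vspace_of_pred (P := fun f : Defs.form L w N => van C f)).
  by move=> q; rewrite form0 meval0.
by move=> a f g vf vg q; rewrite formZD mevalD mevalZ vf vg mulr0 addr0.
Qed.

Definition van_space N := sval (cid (exists_van_space N)).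

Lemma van_spaceP N (f : Defs.form L w N) : f \in van_space N <-> van C f.
Proof. by rewrite /van_space; case: cid. Qed.

(** With f_j = 'X_j / 'X_i0, a form H of degree N gives a function
    a(t)^N H / 'X_i0^N which, by induction on N, is a combination of box monomials
    with coefficients of degree at most cN in t. Such combinations form a space of
    dimension linear in N, and H vanishes on C if the combination is zero. *)
Lemma hilbert_growth : exists c, forall N,
  (\dim {:Defs.form L w N} <= c * N.+1 + \dim (van_space N))%N.
Proof.
have [t [tr alg]] := curve_dim C; have [i0 nv0] := nonvan_var C.
have nx0 : ~ vanishes_on C (DHomog (homogX L i0) : Defs.form L w 1) by move/vanP.
pose f j : ratfun C := RatFun (DHomog (homogX L j) : Defs.form L w 1) nx0.
have fE j (q : pt) : f j (val q) = ev 'X_j q / ev 'X_i0 q by [].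
have [n [a [S [Z [a0 pZ Sn SP]]]]] := algebraic_relations f alg.
have [d [A [hA nA AP]]] := transcendental_form tr a0.
have nD : ~ van C (rden t) by move/vanP; case: (t).
have hD := form_homog (rden t).
pose U q := (val q \notin Z) /\ ev 'X_i0 q != 0.
pose tt q := t (val q); pose ff j q := f j (val q).
have [c step] : exists c, forall M phi j, bounded_comb U n.+1 tt ff M phi ->
    bounded_comb U n.+1 tt ff (c + M)%N (fun q => a.[tt q] * ff j q * phi q).
  by apply: (bounded_comb_step Sn) => j i q [qZ _]; apply: SP.
have comb N H : H \is N.-homog -> bounded_comb U n.+1 tt ff (c * N).+1
    (fun q => a.[tt q] ^+ N * ev H q / ev 'X_i0 q ^+ N).
  elim: N H => [|N IH] H hH.
    pose b0 : {ffun 'I_w.+1 -> 'I_n.+1} := [ffun=> ord0].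
    rewrite (homog0_meval (fun=> 0) hH); set h := H.@[_].
    apply: (bounded_comb_ext (phi := fun q => h%:P.[tt q] * boxmon ff b0 q)).
      by apply: bounded_comb1; rewrite muln0 size_polyC leq_b1.
    move=> q _; rewrite mevalC hornerC !expr0 divr1 mul1r /boxmon big1 ?mulr1 //.
    by move=> j _; rewrite ffunE expr0.
  have [G hG ->] := homogS_sum hH.
  apply: (bounded_comb_ext (phi := fun q => \sum_j a.[tt q] * ff j q *
     (a.[tt q] ^+ N * ev (G j) q / ev 'X_i0 q ^+ N))).
    apply: bounded_comb_sum => j; rewrite mulnS -addnS; apply: step.
    exact: IH.
  move=> q [_ x0]; rewrite raddf_sum mulr_sumr mulr_suml; apply: eq_bigr => j _.
  rewrite /= mevalM /ff fE.
  by rewrite !exprS invfM; ring.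
(* a combination of box monomials is recorded by the matrix x whose rows list the
   coefficients of the polynomials in t *)
pose B := {ffun 'I_w.+1 -> 'I_n.+1}; exists (#|B| * c.+1)%N => N.
pose M := (c * N).+1.
pose rho (H : Defs.form L w N) (x : 'M[L]_(#|B|, M)) := forall q, U q ->
  a.[tt q] ^+ N * ev H q / ev 'X_i0 q ^+ N =
  \sum_(b : B) (rVpoly (row (enum_rank b) x)).[tt q] * boxmon ff b q.
have : (\dim {:Defs.form L w N} + \dim (0%VS : {vspace 'M[L]_(#|B|, M)}) <=
  \dim {:'M[L]_(#|B|, M)} + \dim (van_space N))%N.
  apply: (rel_dim (rho := rho)).
  - move=> q _; rewrite form0 meval0 mulr0 mul0r big1 // => b _.
    by rewrite linear0 linear0 horner0 mul0r.
  - move=> x F G y z rF rG q Uq; rewrite formZD mevalD mevalZ.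
    transitivity (x * (a.[tt q] ^+ N * ev F q / ev 'X_i0 q ^+ N) +
      (a.[tt q] ^+ N * ev G q / ev 'X_i0 q ^+ N)); first by ring.
    rewrite rF // rG // mulr_sumr -big_split; apply: eq_bigr => b _ /=.
    by rewrite linearP linearP hornerD hornerZ; ring.
  - move=> H; have [b bM E] := comb N H (form_homog H).
    exists (\matrix_i poly_rV (b (enum_val i))); first exact: memvf.
    move=> q Uq; rewrite E //; apply: eq_bigr => e _.
    by rewrite rowK enum_rankK poly_rV_K.
  - move=> H x; rewrite memv0 => /eqP -> rH; apply/van_spaceP.
    pose W : {pred ppoint L w} := [predU Z & [predU
      [pred p | ('X_i0 : P).@[pcoord p] == 0] & [predU
      [pred p | A.@[pcoord p] == 0] & [pred p | (rden t : P).@[pcoord p] == 0]]]].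
    have pW : proper_closed C W.
      do 2?[apply: proper_closedU => //]; first exact: proper_closed_zeros (homogX _ _) nv0.
      by apply: proper_closedU; [exact: proper_closed_zeros hA nA | exact: proper_closed_zeros hD nD].
    apply: (generic_van pW (form_homog H)) => q; rewrite !inE !negb_or.
    move=> /and4P[qZ x0 Aq Dq]; have := rH q (conj qZ x0).
    rewrite [RHS]big1 => [|b _]; last by rewrite linear0 linear0 horner0 mul0r.
    move/eqP; rewrite mulf_eq0 invr_eq0 [X in _ || X](negPf (expf_neq0 _ x0)) orbF.
    rewrite mulf_eq0 expf_eq0 => /orP[/andP[_ /eqP aq]|/eqP //].
    by rewrite (AP q Dq aq) eqxx in Aq.
  exact: sub0v.
rewrite dimv0 addn0 => le; apply: leq_trans le _; rewrite leq_add2r dimvf dim_matrix.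
rewrite -mulnA leq_mul2l; apply/orP; right; rewrite /M mulSn mulnS.
by rewrite addnC -addn1; apply: leq_add; [exact: leq_addl | by []].
Qed.

End Growth.

(** * Local parameters *)

Section HomogMatrix.
Variables (L : fieldType) (m : nat).

Lemma homog_sum d (I : Type) (r : seq I) (Q : pred I) (F : I -> {mpoly L[m]}) :
  (forall i, Q i -> F i \is d.-homog) -> \sum_(i <- r | Q i) F i \is d.-homog.
Proof. by move=> h; apply: rpred_sum. Qed.

Lemma homog_prodr e (I : Type) (r : seq I) (F : I -> {mpoly L[m]}) :
  (forall i, F i \is e.-homog) -> \prod_(i <- r) F i \is (e * size r)%N.-homog.
Proof.
move=> h; elim: r => [|i r IH]; first by rewrite big_nil muln0 dhomog1.
by rewrite big_cons /= mulnS; apply: dhomogM.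
Qed.

Lemma homog_sign d k (F : {mpoly L[m]}) : F \is d.-homog -> (-1) ^+ k * F \is d.-homog.
Proof. by move=> hF; rewrite -signr_odd mulr_sign; case: odd => //; rewrite rpredN. Qed.

Lemma homog_det e n (A : 'M[{mpoly L[m]}]_n) :
  (forall i j, A i j \is e.-homog) -> \det A \is (e * n)%N.-homog.
Proof.
move=> hA; apply: homog_sum => s _; apply: homog_sign.
have /= := homog_prodr (index_enum 'I_n) (fun i => hA i (s i)).
by rewrite /index_enum -enumT size_enum_ord.
Qed.

Lemma homog_adj e n (A : 'M[{mpoly L[m]}]_n.+1) :
  (forall i j, A i j \is e.-homog) -> forall i j, \adj A i j \is (e * n)%N.-homog.
Proof.
move=> hA i j; rewrite mxE /cofactor; apply: homog_sign; apply: homog_det => k l.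
by rewrite !mxE.
Qed.

End HomogMatrix.

Section Uniformizer.

Variables (L : closedFieldType) (w : nat) (C : curve L w).
Local Notation P := {mpoly L[w.+1]}.
Local Notation pt := {p : ppoint L w | p \in curve_set C}.
Implicit Types (F G H : P) (p q : pt) (Z : {pred ppoint L w}).

(** Normalised coordinate vectors that are proportional have their first non-zero
    entry, equal to 1, at the same place. *)
Lemma ppoint_proportional (x y : ppoint L w) c :
  (forall j, pcoord x j = c * pcoord y j) -> x = y.
Proof.
move=> E; apply: val_inj; apply/ffunP => j.
case: x y E => x /= /existsP[i /andP[/eqP xi /forallP x0]].
move=> [y /= /existsP[k /andP[/eqP yk /forallP y0]]] E.
suff ik : i = k by have := E i; rewrite xi ik yk mulr1 E => <-; rewrite mul1r.
apply/val_inj/anti_leq/andP; split; rewrite leqNgt; apply/negP => lt.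
  have := x0 k; rewrite lt E yk mulr1 => /eqP c0.
  by have := E i; rewrite xi c0 mul0r => /eqP; rewrite oner_eq0.
have := y0 i; rewrite lt => /eqP yi; have := E i.
by rewrite xi yi mulr0 => /eqP; rewrite oner_eq0.
Qed.

Lemma ev_shift (a : 'I_w.+1 -> L) i j q :
  ev (shift a i j) q = pcoord (val q) j - a j * pcoord (val q) i.
Proof. by rewrite mevalB mevalZ !mevalXU. Qed.

Lemma separating_form p q : p != q ->
  exists F, [/\ F \is 1.-homog, ev F q = 0 & ev F p != 0].
Proof.
move=> pq; have [i qi] := coord_unit (val q).
have [j pj] : exists j, ev (shift (pcoord (val q)) i j) p != 0.
  apply: contrapT => all; case/eqP: pq; apply: val_inj.
  apply: (@ppoint_proportional _ _ (pcoord (val p) i)) => j.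
  apply: contrapT => /eqP ne; apply: all; exists j.
  by rewrite ev_shift subr_eq0 mulrC.
exists (shift (pcoord (val q)) i j); split=> //; first exact: homog_shift.
by rewrite ev_shift qi mulr1 subrr.
Qed.

(** The linear form t, divided by a linear form that is non-zero at p, generates the
    maximal ideal of the local ring at p: each F vanishing at p is locally
    (g / h) t with h a unit. The degree m + 1 of h makes the degree m + d of g exact
    without truncated subtraction. *)
Definition local_parameter p (t : P) : Prop :=
  [/\ t \is 1.-homog, ev t p = 0, ~ van C t &
  forall d F, F \is d.-homog -> ev F p = 0 ->
    exists m h g, [/\ h \is m.+1.-homog, g \is (m + d)%N.-homog, ev h p != 0 &
      forall q, ev h q * ev F q = ev g q * ev t q]].

Lemma meval_mderivX (a : 'I_w.+1 -> L) j l : (mderiv l ('X_j : P)).@[a] = (j == l)%:R.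
Proof.
rewrite mderivX mnm1E mevalZ; case: eqP => [->|_]; last by rewrite mul0r.
by rewrite -{1}[U_(l)%MM]add0m addmK mpolyX0 meval1 mulr1.
Qed.

Definition gradient (a : 'I_w.+1 -> L) F : 'rV[L]_w.+1 := \row_j (mderiv j F).@[a].

Lemma gradientD a b F G : gradient a (b *: F + G) = b *: gradient a F + gradient a G.
Proof. by apply/rowP => j; rewrite !mxE mderivD mderivZ mevalD mevalZ. Qed.

Lemma gradient_mulXn a F i k : F.@[a] = 0 -> a i = 1 -> gradient a (F * 'X_i ^+ k) = gradient a F.
Proof.
move=> Fa ai; apply/rowP => j; rewrite !mxE mderivM mevalD !mevalM Fa mul0r addr0.
by rewrite rmorphXn /= mevalXU ai expr1n mulr1.
Qed.

(** The tangent space is by definition the annihilator of the gradients of the forms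
    vanishing on C; those gradients form a space, since forms may be multiplied
    by powers of 'X_i to equalise their degrees, and a space is its own double
    annihilator. *)
Lemma gradient_of_annihilator p (u : 'rV[L]_w.+1) :
  (forall v : 'rV[L]_w.+1, tangent_vector C (val p) v -> u *m v^T = 0) ->
  exists d F, [/\ F \is d.+1.-homog, van C F & gradient (pcoord (val p)) F = u].
Proof.
set a := pcoord (val p) => uann; have [i ai] := coord_unit (val p).
pose Q (c : 'rV[L]_w.+1) := exists d F, [/\ F \is d.+1.-homog, van C F & gradient a F = c].
have [U UP] : exists U : {vspace 'rV[L]_w.+1}, forall c, c \in U <-> Q c.
  apply: vspace_of_pred.
    exists 0%N, 0; split; [exact: dhomog0 | by move=> q; rewrite meval0|].
    by apply/rowP => j; rewrite !mxE mderiv0 meval0.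
  move=> b _ _ [d [F [hF vF <-]]] [e [G [hG vG <-]]].
  exists (d + e.+1)%N, (b *: (F * 'X_i ^+ e.+1) + G * 'X_i ^+ d.+1); split.
  - apply: rpredD; first by apply: rpredZ; rewrite -addSn; apply: dhomogM; rewrite ?homogXn.
    by rewrite -addSn addnC; apply: dhomogM; rewrite ?homogXn.
  - by move=> q; rewrite mevalD mevalZ !mevalM vF vG !mul0r mulr0 addr0.
  - by rewrite gradientD !gradient_mulXn ?vF ?vG.
apply/UP; pose M : 'M[L]_(\dim U, w.+1) := \matrix_r (vbasis U)`_r.
have UM c : c \in U <-> (c <= M)%MS.
  split=> [cU|/submxP[x ->]].
    rewrite (coord_vbasis cU); apply: summx_sub => r _; apply: scalemx_sub.
    by rewrite -(rowK (fun r : 'I_(\dim U) => (vbasis U)`_r)) row_sub.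
  rewrite mulmx_sum_row; apply: memv_suml => r _; apply: memvZ.
  by rewrite rowK vbasis_mem ?mem_nth ?size_tuple.
apply/UM; rewrite submxE; apply/eqP/rowP => j; rewrite !mxE.
have tj : tangent_vector C (val p) (col j (cokermx M))^T.
  move=> d F /vanP vF.
  have : gradient a ((F : P) * 'X_i ^+ 1) \in U.
    apply/UP; exists d, ((F : P) * 'X_i ^+ 1); split=> //.
      by have := dhomogM (form_homog F) (homogXn L i 1); rewrite addn1.
    by move=> q; rewrite mevalM vF mul0r.
  rewrite gradient_mulXn ?vF // => /UM; rewrite submxE => /eqP/rowP/(_ j).
  by rewrite !mxE => E; rewrite -[RHS]E; apply: eq_bigr => k _; rewrite !mxE.
have := uann _ tj; rewrite trmxK => /matrixP/(_ 0 0); rewrite !mxE => E.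
by rewrite -[RHS]E; apply: eq_bigr => k _; rewrite !mxE.
Qed.

(** Euler's identity: the derivative of F along p is deg F times F(p). *)
Lemma euler_tangent p : tangent_vector C (val p) (\row_j pcoord (val p) j).
Proof.
move=> d F /vanP vF; have hF := form_homog F.
have E : \sum_j (mderiv j (F : P)).@[pcoord (val p)] * pcoord (val p) j
   = d%:R * ev F p.
  rewrite {2}(mpolyE (F : P)) raddf_sum mulr_sumr /=.
  transitivity (\sum_j \sum_(m <- msupp (F : P)) (mderiv j ((F : P)@_m *: 'X_[m])).@[pcoord (val p)]
     * pcoord (val p) j).
    by apply: eq_bigr => j _; rewrite {1}(mpolyE (F : P)) [mderiv j _]raddf_sum raddf_sum mulr_suml.
  rewrite exchange_big; apply: eq_big_seq => m mF /=.
  transitivity (\sum_(j < w.+1) (m j)%:R * ev ((F : P)@_m *: 'X_[m]) p).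
    apply: eq_bigr => j _; rewrite mderivZ !mevalZ mderivX mevalZ -!mulrA mulrCA.
    have [->|mj] := posnP (m j); first by rewrite !mul0r.
    congr (_ * (_ * _)); rewrite -[in RHS](@submK _ U_(j)%MM m); last first.
      by rewrite lep1mP -lt0n.
    by rewrite mpolyXD mevalM mevalXU.
  by rewrite -mulr_suml -natr_sum -mdegE (dhomogP _ _ _ hF m mF).
transitivity (d%:R * ev F p); last by rewrite vF mulr0.
by rewrite -E; apply: eq_bigr => j _; rewrite mxE.
Qed.

(** The tangent plane M is spanned by p and one more vector v. The forms y_j =
    'X_j - a_j 'X_i vanish at p, and some y_k does not vanish at v; hence a
    combination y_j - c y_k vanishes on M and is the gradient of a form F in the
    ideal of C. *)
Lemma smooth_gradients p i : smooth_at C (val p) -> pcoord (val p) i = 1 ->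
  exists k, forall j, exists c d F, [/\ F \is d.+1.-homog, van C F &
    gradient (pcoord (val p)) F = gradient (pcoord (val p))
      (shift (pcoord (val p)) i j - c *: shift (pcoord (val p)) i k)].
Proof.
set a := pcoord (val p) => -[M rM MP] ai.
pose A : 'rV[L]_w.+1 := \row_j a j.
have AM : (A <= M)%MS by apply/MP; exact: euler_tangent.
have A0 : A != 0 by apply/eqP => /rowP/(_ i); rewrite !mxE ai => /eqP; rewrite oner_eq0.
have [v vM vA] : exists2 v : 'rV[L]_w.+1, (v <= M)%MS & ~~ (v <= A)%MS.
  apply: contrapT => all; have : (M <= A)%MS.
    apply/row_subP => r; apply: contrapT => /negP n; apply: all.
    by exists (row r M) => //; apply: row_sub.
  by move/mxrankS; rewrite rM leqNgt ltnS rank_leq_row.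
have M_eq : (M <= A + v)%MS.
  have sub : (A + v <= M)%MS by rewrite addsmx_sub AM vM.
  rewrite -(mxrank_leqif_sup sub).2 eqn_leq (mxrank_leqif_sup sub).1 rM /=.
  have : (A < A + v)%MS.
    by rewrite ltmxE addsmxSl /=; apply: contra vA; apply: submx_trans; apply: addsmxSr.
  by move/rank_ltmx; rewrite rank_rV A0.
pose y j (x : 'rV[L]_w.+1) := x 0 j - a j * x 0 i.
have [k yk] : exists k, y k v != 0.
  apply: contrapT => all; case/negP: vA; apply/sub_rVP; exists (v 0 i).
  apply/rowP => j; rewrite !mxE; apply: contrapT => /eqP ne; apply: all; exists j.
  by rewrite /y subr_eq0 mulrC.
have grad_shift j l : (mderiv l (shift a i j)).@[a] = (j == l)%:R - a j * (i == l)%:R.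
  by rewrite mderivB mderivZ mevalB mevalZ !meval_mderivX.
have pair j x : (gradient a (shift a i j) *m x^T) 0 0 = y j x.
  rewrite !mxE; under eq_bigr => l _ do rewrite !mxE grad_shift mulrBl -mulrA.
  rewrite big_split /= sumrN -mulr_sumr /y; congr (_ - _ * _).
    by rewrite (bigD1 j) //= eqxx mul1r big1 ?addr0 // => l /negPf lj; rewrite eq_sym lj mul0r.
  by rewrite (bigD1 i) //= eqxx mul1r big1 ?addr0 // => l /negPf lj; rewrite eq_sym lj mul0r.
exists k => j; exists (y j v / y k v); apply: gradient_of_annihilator => x /MP xM.
have /sub_addsmxP[[z1 z2] /= Ex] := submx_trans xM M_eq.
apply/matrixP => r s; rewrite !ord1 [RHS]mxE.
rewrite -scaleNr addrC gradientD mulmxDl -scalemxAl mxE [X in X + _]mxE !pair.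
have yx l : y l x = z2 0 0 * y l v.
  have zz : z1 *m A = z1 0 0 *: A by apply/rowP => b; rewrite !mxE big_ord1 !mxE.
  have zv : z2 *m v = z2 0 0 *: v by apply/rowP => b; rewrite !mxE big_ord1.
  rewrite /y Ex zz zv !mxE ai; ring.
by rewrite !yx; field.
Qed.

(** Expand the form F vanishing on C, whose gradient is y_j - c y_k, at p: the linear
    part is y_j - c y_k and the remainder is in the square of the maximal ideal,
    so that its coefficients A_l vanish at p. *)
Lemma square_relation p i k j : pcoord (val p) i = 1 ->
  (exists c d F, [/\ F \is d.+1.-homog, van C F &
    gradient (pcoord (val p)) F = gradient (pcoord (val p))
      (shift (pcoord (val p)) i j - c *: shift (pcoord (val p)) i k)]) ->
  exists c e (A : 'I_w.+1 -> P), [/\ forall l, A l \is e.-homog,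
    forall l, ev (A l) p = 0 &
    forall q, ev 'X_i q ^+ e * (ev (shift (pcoord (val p)) i j) q
       - c * ev (shift (pcoord (val p)) i k) q) =
      \sum_l ev (A l) q * ev (shift (pcoord (val p)) i l) q].
Proof.
set a := pcoord (val p) => ai [c [e [F [hF vF gF]]]].
have [G hG EF] := homog_taylor ai hF.
exists c, e, (fun l => ev (G l) p *: 'X_i ^+ e - G l); split.
- by move=> l; apply: rpredB; [apply: rpredZ; exact: homogXn | exact: hG].
- by move=> l; rewrite mevalB mevalZ rmorphXn /= mevalXU ai expr1n mulr1 subrr.
move=> q; pose y l := ev (shift a i l) q.
have ya l : ev (shift a i l) p = 0 by rewrite ev_shift ai mulr1 subrr.
have gradF l : (mderiv l F).@[a] = ev (G l) p - (i == l)%:R * \sum_m ev (G m) p * a m.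
  have -> : mderiv l F = \sum_m (mderiv l (shift a i m) * G m + shift a i m * mderiv l (G m)).
    rewrite {1}EF vF scale0r add0r raddf_sum; apply: eq_bigr => m _.
    exact: mderivM.
  rewrite raddf_sum /=.
  transitivity (\sum_m ((m == l)%:R * ev (G m) p - (i == l)%:R * (ev (G m) p * a m))).
    apply: eq_bigr => m _; rewrite mevalD !mevalM ya mul0r addr0.
    rewrite mderivB mderivZ mevalB mevalZ !meval_mderivX; ring.
  rewrite big_split /= sumrN mulr_sumr; congr (_ - _).
  rewrite (bigD1 l) //= eqxx mul1r big1 ?addr0 // => m /negPf ml.
  by rewrite ml mul0r.
have yi : y i = 0 by rewrite /y ev_shift ai mul1r subrr.
have dual l : \sum_m (mderiv m (shift a i l)).@[a] * y m = y l.
  transitivity (\sum_m ((l == m)%:R * y m - a l * ((i == m)%:R * y m))).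
    apply: eq_bigr => m _; rewrite mderivB mderivZ mevalB mevalZ !meval_mderivX; ring.
  rewrite big_split /= sumrN -mulr_sumr.
  have pick b : \sum_m ((b == m)%:R * y m) = y b.
    rewrite (bigD1 b) //= eqxx mul1r big1 ?addr0 // => m /negPf mb.
    by rewrite eq_sym mb mul0r.
  by rewrite !pick yi mulr0 subr0.
have sumG : \sum_l ev (G l) p * y l = y j - c * y k.
  transitivity (\sum_l (mderiv l F).@[a] * y l).
    under [RHS]eq_bigr => l _ do rewrite gradF mulrBl.
    rewrite big_split /= sumrN [X in _ - X]big1 ?subr0 // => l _.
    by have [<-|_] := eqVneq i l; rewrite ?yi ?mulr0 // !mul0r.
  transitivity (\sum_l ((mderiv l (shift a i j)).@[a] * y l
      - c * ((mderiv l (shift a i k)).@[a] * y l))).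
    apply: eq_bigr => l _; have /rowP/(_ l) := gF; rewrite !mxE => ->.
    rewrite mderivB mderivZ mevalB mevalZ; ring.
  by rewrite big_split /= sumrN -mulr_sumr !dual.
have sum0 : \sum_l y l * ev (G l) q = 0.
  transitivity (ev F q); last exact: vF.
  rewrite {1}EF mevalD mevalZ vF mul0r add0r raddf_sum /=.
  by apply: eq_bigr => l _; rewrite mevalM.
rewrite -/(y j) -/(y k) -sumG mulr_sumr.
transitivity (\sum_l ev (ev (G l) p *: 'X_i ^+ e - G l) q * ev (shift a i l) q +
  \sum_l y l * ev (G l) q); last by rewrite sum0 addr0.
rewrite -big_split.
apply: eq_bigr => l _; rewrite mevalB mevalZ rmorphXn /= -/(y l); ring.
Qed.

(** The relations form a linear system B y = (multiple of y_k), with B the identity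
    matrix at p. Multiplication by the adjugate solves it with the denominator
    det B, which is a unit at p. *)
Lemma nakayama p i k : pcoord (val p) i = 1 ->
  (forall j, exists c e (A : 'I_w.+1 -> P), [/\ forall l, A l \is e.-homog,
    forall l, ev (A l) p = 0 &
    forall q, ev 'X_i q ^+ e * (ev (shift (pcoord (val p)) i j) q
       - c * ev (shift (pcoord (val p)) i k) q) =
      \sum_l ev (A l) q * ev (shift (pcoord (val p)) i l) q]) ->
  exists d h (g : 'I_w.+1 -> P), [/\ h \is d.-homog, forall j, g j \is d.-homog,
    ev h p != 0 & forall j q, ev h q * ev (shift (pcoord (val p)) i j) q =
      ev (g j) q * ev (shift (pcoord (val p)) i k) q].
Proof.
set a := pcoord (val p) => ai rel.
have rel' j : exists v : L * nat * ('I_w.+1 -> P), [/\ forall l, v.2 l \is v.1.2.-homog,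
    forall l, ev (v.2 l) p = 0 &
    forall q, ev 'X_i q ^+ v.1.2 * (ev (shift a i j) q - v.1.1 * ev (shift a i k) q) =
      \sum_l ev (v.2 l) q * ev (shift a i l) q].
  by have [c [e [A AP]]] := rel j; exists (c, e, A).
have [v vP] := choice rel'.
(* a common bound for the exponents, to make all entries of B of the same degree *)
pose E := (\sum_j (v j).1.2)%N; pose c j := (v j).1.1.
have Ej j : ((v j).1.2 <= E)%N by rewrite /E (bigD1 j) //= leq_addr.
pose A : 'M[P]_w.+1 := \matrix_(j, l) ('X_i ^+ (E - (v j).1.2) * (v j).2 l).
pose B := ('X_i ^+ E)%:M - A.
have hA j l : A j l \is E.-homog.
  rewrite mxE -[X in X.-homog](subnK (Ej j)); apply: dhomogM; first exact: homogXn.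
  by case: (vP j).
have hB j l : B j l \is E.-homog.
  rewrite /B !mxE; apply: rpredB; last by have := hA j l; rewrite mxE.
  by case: (j == l); rewrite ?mulr1n ?mulr0n; [exact: homogXn | exact: dhomog0].
pose g j := \sum_l c l *: (\adj B j l * 'X_i ^+ E).
exists (E * w.+1)%N, (\det B), g; split.
- exact: homog_det.
- move=> j; apply: homog_sum => l _; apply: rpredZ; rewrite mulnSr.
  by apply: dhomogM; [exact: homog_adj | exact: homogXn].
- have -> : ev (\det B) p = \det (map_mx (fun F => ev F p) B) by rewrite det_map_mx.
  have -> : map_mx (fun F => ev F p) B = 1%:M.
    apply/matrixP => j l; rewrite !mxE mevalB mevalM.
    have [_ -> _] := vP j; rewrite mulr0 subr0 mevalMn rmorphXn /= mevalXU ai expr1n.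
    by [].
  by rewrite det1 oner_neq0.
move=> j q; pose y : 'cV[L]_w.+1 := \col_l ev (shift a i l) q.
pose Bq := map_mx (fun F => ev F q) B.
have By l : (Bq *m y) l 0 = ev 'X_i q ^+ E * c l * ev (shift a i k) q.
  have [_ _ /(_ q) El] := vP l.
  rewrite /Bq /B mxE.
  transitivity (\sum_m ((l == m)%:R * (ev 'X_i q ^+ E * y m 0) -
     ev 'X_i q ^+ (E - (v l).1.2) * (ev ((v l).2 m) q * ev (shift a i m) q))).
    apply: eq_bigr => m _; rewrite !mxE mevalB mevalM mevalMn !rmorphXn /=.
    by rewrite -mulr_natl; ring.
  rewrite big_split /= sumrN -mulr_sumr -El (bigD1 l) //= eqxx mul1r big1; last first.
    by move=> m /negPf lm; rewrite eq_sym lm mul0r.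
  rewrite addr0 mxE mulrA -exprD subnK //; ring.
have : (\adj Bq *m Bq *m y) j 0 = \det Bq * y j 0 by rewrite mul_adj_mx mul_scalar_mx mxE.
rewrite -mulmxA mxE.
have -> : \det Bq = ev (\det B) q by rewrite /Bq det_map_mx.
rewrite [y j 0]mxE => <-; rewrite /g raddf_sum mulr_suml; apply: eq_bigr => l _ /=.
rewrite By mevalZ mevalM rmorphXn /= /Bq -map_mx_adj mxE; ring.
Qed.

(** The linear forms y_j generate the maximal ideal at p, and each is a multiple of
    one of them, y_k. *)
Lemma local_parameter_exists p : smooth_at C (val p) -> exists t, local_parameter p t.
Proof.
move=> sm; have [i pi] := coord_unit (val p); set a := pcoord (val p) in pi.
have [k kP] := smooth_gradients sm pi.
have [d [h [g [hh hg hp E]]]] := nakayama pi (fun j => square_relation pi (kP j)).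
exists (shift a i k); split.
- exact: homog_shift.
- by rewrite ev_shift pi mulr1 subrr.
(* otherwise all the linear forms vanishing at p would vanish on C *)
- move=> vk; have [q0 q0p] := curve_two_points p.
  case/eqP: q0p; apply: val_inj; apply: (@ppoint_proportional _ _ (pcoord (val q0) i)) => j.
  have : van C (h * shift a i j) by move=> q; rewrite mevalM E vk mulr0.
  case/(van_mul hh (homog_shift _ _ _)) => [/(_ p)/eqP|/(_ q0)]; first by rewrite (negPf hp).
  by rewrite ev_shift => /eqP; rewrite subr_eq0 mulrC => /eqP.
move=> [|e] F hF Fp.
  exists 0%N, 'X_i, 0; split; [exact: homogX | exact: dhomog0 | by rewrite mevalXU pi oner_neq0 |].
  by move=> q; rewrite (homog0_meval a hF) Fp mevalC mulr0 ?meval0 mul0r.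
have [G hG EF] := homog_taylor pi hF.
exists d, ('X_i * h), ('X_i * \sum_j g j * G j); split.
- exact: (dhomogM (homogX _ i) hh).
- rewrite addnS; apply: (dhomogM (homogX _ i)).
  by apply: homog_sum => j _; apply: dhomogM.
- by rewrite mevalM mevalXU pi mul1r.
move=> q; rewrite EF mevalD mevalZ Fp mul0r add0r raddf_sum !mevalM raddf_sum /=.
rewrite -mulrA -[RHS]mulrA; congr (_ * _); rewrite mulr_sumr mulr_suml.
apply: eq_bigr => j _; rewrite !mevalM mulrA E; ring.
Qed.

End Uniformizer.

(** * Orders of vanishing *)

Section Orders.

Variables (L : closedFieldType) (w : nat) (C : curve L w).
Local Notation P := {mpoly L[w.+1]}.
Local Notation pt := {p : ppoint L w | p \in curve_set C}.
Implicit Types (F G H : P) (p q : pt) (D : seq pt).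
Variable t : pt -> P.
Hypothesis tP : forall p, local_parameter p (t p).

Lemma homog_t p : t p \is 1.-homog. Proof. by case: (tP p). Qed.
Lemma t0 p : ev (t p) p = 0. Proof. by case: (tP p). Qed.
Lemma nonvan_t p : ~ van C (t p). Proof. by case: (tP p). Qed.

(** Locally at p, F is (g / h) t^n with h a unit; the equation on degrees says that
    both sides of h F = g t^n are homogeneous of the same degree. *)
Definition factors p n d F g := exists m k h,
  [/\ h \is m.-homog, g \is k.-homog, (m + d = k + n)%N, ev h p != 0 &
      forall q, ev h q * ev F q = ev g q * ev (t p) q ^+ n].

Definition ord_ge p n d F := exists g, factors p n d F g.
Definition ord_eq p n d F := exists2 g, factors p n d F g & ev g p != 0.

Lemma ord_eqW p n d F : ord_eq p n d F -> ord_ge p n d F.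
Proof. by case=> g; exists g. Qed.

Lemma ord_ge_ext p n d F G : (forall q, ev F q = ev G q) -> ord_ge p n d F -> ord_ge p n d G.
Proof.
move=> FG [g [m [k [h [hh hg mk hp E]]]]]; exists g, m, k, h; split=> // q.
by rewrite -FG E.
Qed.

Lemma ord_eq_ext p n d F G : (forall q, ev F q = ev G q) -> ord_eq p n d F -> ord_eq p n d G.
Proof.
move=> FG [g [m [k [h [hh hg mk hp E]]]] gp]; exists g => //; exists m, k, h; split=> // q.
by rewrite -FG E.
Qed.

Lemma ord_ge0 p d F : F \is d.-homog -> ord_ge p 0 d F.
Proof.
move=> hF; exists F, 0%N, d, 1; split=> //; first exact: dhomog1.
- by rewrite addn0.
- by rewrite meval1 oner_neq0.
by move=> q; rewrite meval1 mul1r expr0 mulr1.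
Qed.

Lemma ord_eq0 p d F : F \is d.-homog -> ev F p != 0 -> ord_eq p 0 d F.
Proof.
move=> hF Fp; exists F => //; exists 0%N, d, 1; split=> //; first exact: dhomog1.
- by rewrite addn0.
- by rewrite meval1 oner_neq0.
by move=> q; rewrite meval1 mul1r expr0 mulr1.
Qed.

Lemma ord_geW p n n' d F : (n' <= n)%N -> ord_ge p n d F -> ord_ge p n' d F.
Proof.
move=> le [g [m [k [h [hh hg mk hp E]]]]].
exists (g * t p ^+ (n - n')), m, (k + (n - n'))%N, h; split=> //.
- by apply: dhomogM => //; rewrite -[X in X.-homog]mul1n; apply: homog_exp; exact: homog_t.
- by rewrite -addnA subnK.
- by move=> q; rewrite E mevalM rmorphXn /= -mulrA -exprD subnK.
Qed.

Lemma factorsM p n d F g n' d' F' g' : factors p n d F g -> factors p n' d' F' g' ->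
  factors p (n + n') (d + d') (F * F') (g * g').
Proof.
move=> [m [k [h [hh hg mk hp E]]]] [m' [k' [h' [hh' hg' mk' hp' E']]]].
exists (m + m')%N, (k + k')%N, (h * h'); split.
- exact: dhomogM.
- exact: dhomogM.
- lia.
- by rewrite mevalM mulf_neq0.
move=> q; rewrite !mevalM exprD.
by rewrite mulrACA E E' mulrACA.
Qed.

Lemma ord_geM p n d F n' d' F' : ord_ge p n d F -> ord_ge p n' d' F' ->
  ord_ge p (n + n') (d + d') (F * F').
Proof. by move=> [g gF] [g' gF']; exists (g * g'); apply: factorsM. Qed.

Lemma ord_eqM p n d F n' d' F' : ord_eq p n d F -> ord_eq p n' d' F' ->
  ord_eq p (n + n') (d + d') (F * F').
Proof.
move=> [g gF gp] [g' gF' gp']; exists (g * g'); first exact: factorsM.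
by rewrite mevalM mulf_neq0.
Qed.

Lemma ord_eqX p n d F e : ord_eq p n d F -> ord_eq p (n * e) (d * e) (F ^+ e).
Proof.
move=> o; elim: e => [|e IH]; last by rewrite exprS !mulnS; apply: ord_eqM.
rewrite !muln0 expr0; apply: ord_eq0; first exact: dhomog1.
by rewrite meval1 oner_neq0.
Qed.

(** Bringing both local expressions over the denominator h h'. *)
Lemma ord_ge_common p n d F G : ord_ge p n d F -> ord_ge p n d G ->
  exists m k h f g, [/\ [/\ h \is m.-homog, f \is k.-homog & g \is k.-homog],
    (m + d = k + n)%N, ev h p != 0 &
    forall q, ev h q * ev F q = ev f q * ev (t p) q ^+ n /\
              ev h q * ev G q = ev g q * ev (t p) q ^+ n].
Proof.
move=> [f [m [k [h [hh hf mk hp E]]]]] [g [m' [k' [h' [hh' hg mk' hp' E']]]]].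
exists (m + m')%N, (k + m')%N, (h * h'), (f * h'), (g * h); split.
- split; [exact: dhomogM | exact: dhomogM |].
  by have -> : (k + m' = k' + m)%N by [lia]; apply: dhomogM.
- lia.
- by rewrite mevalM mulf_neq0.
move=> q; rewrite !mevalM; split.
  by rewrite mulrAC E mulrAC.
by rewrite -mulrA E' mulrCA mulrA.
Qed.

Lemma ord_ge_lin p n d F G a : ord_ge p n d F -> ord_ge p n d G ->
  ord_ge p n d (a *: F + G).
Proof.
move=> oF oG; have [m [k [h [f [g [[hh hf hg] mk hp E]]]]]] := ord_ge_common oF oG.
exists (a *: f + g), m, k, h; split=> //.
  by apply: rpredD => //; apply: rpredZ.
move=> q; have [E1 E2] := E q; rewrite !mevalD !mevalZ mulrDr mulrCA E1 E2; ring.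
Qed.

(** The zero function is divisible by every power of t. *)
Lemma ord_ge_van p n d F : van C F -> ord_ge p n d F.
Proof.
move=> vF; have [i pi] := coord_unit (val p).
exists 0, n, d, ('X_i ^+ n); split.
- exact: homogXn.
- exact: dhomog0.
- exact: addnC.
- by rewrite rmorphXn /= mevalXU pi expr1n oner_neq0.
by move=> q; rewrite vF meval0 mulr0 mul0r.
Qed.

(** If g is not a unit, then it is itself a multiple of t locally. *)
Lemma ord_ge_step p n d F g : factors p n d F g -> ev g p = 0 -> ord_ge p n.+1 d F.
Proof.
move=> [m [k [h [hh hg mk hp E]]]] gp; have [_ _ _ loc] := tP p.
have [m' [h' [g' [hh' hg' hp' E']]]] := loc _ _ hg gp.
exists g', (m'.+1 + m)%N, (m' + k)%N, (h' * h); split=> //.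
- exact: dhomogM.
- lia.
- by rewrite mevalM mulf_neq0.
move=> q; rewrite mevalM exprS -mulrA E mulrA E'; ring.
Qed.

Lemma ord_ge_or_eq p n d F : ord_ge p n d F -> ord_eq p n d F \/ ord_ge p n.+1 d F.
Proof.
move=> [g gF]; have [gp|gp] := eqVneq (ev g p) 0; last by left; exists g.
by right; apply: ord_ge_step gF gp.
Qed.

(** If n < n', cancelling t^n in g h' t^n = g' h t^(n') would make the unit g h'
    vanish at p. *)
Lemma ord_eq_ge p n n' d F : F \is d.-homog -> ord_eq p n d F -> ord_ge p n' d F -> (n' <= n)%N.
Proof.
move=> hF [g [m [k [h [hh hg mk hp E]]]] gp] oF; rewrite leqNgt; apply/negP => lt.
have [g' [m' [k' [h' [hh' hg' mk' hp' E']]]]] := ord_geW lt oF.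
have key : forall q, ev (h' * g) q = ev (h * g' * t p) q.
  apply: (@ev_cancel _ _ _ (m' + k)%N (1 * n)%N _ _ (t p ^+ n)).
  - exact: dhomogM.
  - have -> : (m' + k = m + k' + 1)%N by lia.
    by apply: dhomogM; [exact: dhomogM | exact: homog_t].
  - by apply: homog_exp; exact: homog_t.
  - by apply: nonvan_exp (homog_t p) (@nonvan_t p).
  move=> q; rewrite !mevalM rmorphXn /=.
  transitivity (ev h q * (ev h' q * ev F q)); last by rewrite E' exprS; ring.
  by rewrite mulrCA E mulrA.
have /eqP := key p; rewrite !mevalM t0 mulr0 mulf_eq0.
by rewrite (negPf hp') (negPf gp).
Qed.

Lemma ord_eq_unique p n n' d F : F \is d.-homog -> ord_eq p n d F -> ord_eq p n' d F -> n = n'.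
Proof.
move=> hF o o'; apply/anti_leq/andP; split.
  by apply: (ord_eq_ge hF o'); apply: ord_eqW.
by apply: (ord_eq_ge hF o); apply: ord_eqW.
Qed.

Lemma ord_eq_nonvan p n d F : F \is d.-homog -> ord_eq p n d F -> ~ van C F.
Proof.
move=> hF oF /(ord_ge_van p n.+1 d) /(ord_eq_ge hF oF).
by rewrite ltnn.
Qed.

Lemma ord_ge1 p d F : F \is d.-homog -> ev F p = 0 -> ord_ge p 1 d F.
Proof.
move=> hF Fp; apply: (@ord_ge_step p 0 d F F) => //.
exists 0%N, d, 1; split=> //; first exact: dhomog1.
- by rewrite addn0.
- by rewrite meval1 oner_neq0.
by move=> q; rewrite meval1 mul1r expr0 mulr1.
Qed.

Lemma ord_eq_t p : ord_eq p 1 1 (t p).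
Proof.
exists 1; last by rewrite meval1 oner_neq0.
exists 0%N, 0%N, 1; split=> //; [exact: dhomog1 | exact: dhomog1 |].
by rewrite meval1 oner_neq0.
Qed.

(** F contains the weighted set given by the list D, in which points are repeated
    according to their multiplicity. *)
Definition along D d F := forall p, ord_ge p (count_mem p D) d F.

Lemma along_space D d : exists U : {vspace Defs.form L w d},
  forall f : Defs.form L w d, f \in U <-> along D d f.
Proof.
apply: (vspace_of_pred (P := fun f : Defs.form L w d => along D d f)).
  by move=> p; rewrite form0; apply: ord_ge_van => q; rewrite meval0.
by move=> a f g af ag p; rewrite formZD; apply: ord_ge_lin.
Qed.

Definition alongv D d := sval (cid (along_space D d)).

Lemma alongvP D d (f : Defs.form L w d) : f \in alongv D d <-> along D d f.
Proof. by rewrite /alongv; case: cid. Qed.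

Lemma along_cons p D d F : along (p :: D) d F -> along D d F.
Proof. by move=> a q; apply: ord_geW (a q); rewrite /= leq_addl. Qed.

Lemma along_consP p D d F : along D d F -> ord_ge p (count_mem p D).+1 d F -> along (p :: D) d F.
Proof.
move=> a o q; rewrite /=; case: (eqVneq p q) => [<-|_]; last exact: a.
exact: o.
Qed.

Lemma alongv_van D d : (van_space C d <= alongv D d)%VS.
Proof. by apply/subvP => f /van_spaceP vf; apply/alongvP => p; apply: ord_ge_van. Qed.

Lemma alongv_nil d : alongv [::] d = fullv.
Proof.
apply/vspaceP => f; rewrite memvf; apply/alongvP => p.
exact: ord_ge0 (form_homog f).
Qed.

(** If f contains D but not p + D, then the leading coefficient at p of any other form
    containing D is a multiple of that of f, and subtracting this multiple of f
    raises the order at p. *)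
Lemma dim_along_cons p D d : (\dim (alongv D d) <= (\dim (alongv (p :: D) d)).+1)%N.
Proof.
have [sub|/subvPn[f fD fnD]] := boolP (alongv D d <= alongv (p :: D) d)%VS.
  by apply: leqW; exact: dimvS.
have sub : (alongv D d <= alongv (p :: D) d + <[f]>)%VS.
  apply/subvP => e eD.
  have /alongvP af := fD; have /alongvP ae := eD.
  have [m [k [h [u [v [[hh hu hv] mk hp E]]]]]] := ord_ge_common (ae p) (af p).
  have fg : factors p (count_mem p D) d f v by exists m, k, h; split=> // q; case: (E q).
  have vp : ev v p != 0.
    apply: contra fnD => /eqP vp; apply/alongvP; apply: along_consP => //.
    exact: ord_ge_step fg vp.
  rewrite -[e](subrK ((ev u p / ev v p) *: f)) memv_add ?memvZ ?memv_line //.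
  have memeD : e - (ev u p / ev v p) *: f \in alongv D d by rewrite memvB ?memvZ.
  have /alongvP aeD := memeD; apply/alongvP; apply: along_consP => //.
  apply: (@ord_ge_step p _ _ _ (u - (ev u p / ev v p) *: v)).
    exists m, k, h; split=> //; first by apply: rpredB => //; apply: rpredZ.
    move=> q; have [E1 E2] := E q.
    have -> : ((e - (ev u p / ev v p) *: f : Defs.form L w d) : P) =
       (e : P) - (ev u p / ev v p) *: (f : P) by [].
    rewrite !mevalB !mevalZ mulrBr E1 mulrCA E2; ring.
  by rewrite mevalB mevalZ divfK // subrr.
apply: (leq_trans (dimvS sub)); apply: (leq_trans (leq_of_leqif (dimv_add_leqif _ _))).
by rewrite dim_vline; case: (f != 0); rewrite ?addn1 ?addn0.
Qed.

Lemma dim_along_le D d : (\dim {:Defs.form L w d} <= \dim (alongv D d) + size D)%N.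
Proof.
elim: D => [|p D IH]; first by rewrite alongv_nil addn0.
by apply: (leq_trans IH); rewrite /= addnS -addSn leq_add2r dim_along_cons.
Qed.

(** The product of linear forms, one for each point q of D: the local parameter at p
    if q = p, and a form vanishing at q but not at p otherwise. *)
Lemma exact_form p D : exists F, [/\ F \is (size D).-homog, along D (size D) F &
  ord_eq p (count_mem p D) (size D) F].
Proof.
elim: D => [|q D [F [hF aF oF]]].
  exists 1; split; first exact: dhomog1.
    by move=> q; apply: ord_ge0; exact: dhomog1.
  by apply: ord_eq0; [exact: dhomog1 | rewrite meval1 oner_neq0].
have [l [hl lq ol]] : exists l, [/\ l \is 1.-homog, ev l q = 0 & ord_eq p (q == p) 1 l].
  have [->|qp] := eqVneq q p.
    by exists (t p); split; [exact: homog_t | exact: t0 | exact: ord_eq_t].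
  rewrite eq_sym in qp; have [l [hl lq lp]] := separating_form qp.
  by exists l; split=> //; apply: ord_eq0.
exists (l * F); split; first exact: (dhomogM hl hF).
  move=> x; rewrite /= -[(size D).+1]add1n; apply: ord_geM => //.
  case: eqP => [<-|_]; [exact: ord_ge1 | exact: ord_ge0].
by rewrite /= -[(size D).+1]add1n; apply: ord_eqM.
Qed.

Lemma exact_form_up p D N : (size D <= N)%N -> exists F, [/\ F \is N.-homog, along D N F &
  ord_eq p (count_mem p D) N F].
Proof.
move=> DN; have [F [hF aF oF]] := exact_form p D; have [i pi] := coord_unit (val p).
rewrite -(subnK DN); exists ('X_i ^+ (N - size D) * F); split.
- by apply: dhomogM => //; exact: homogXn.
- by move=> q; rewrite -[count_mem _ _]add0n; apply: ord_geM => //; apply/ord_ge0/homogXn.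
rewrite -[count_mem _ _]add0n; apply: ord_eqM => //; apply: ord_eq0; first exact: homogXn.
by rewrite rmorphXn /= mevalXU pi expr1n oner_neq0.
Qed.

(** In degrees at least |D| the successive inclusions are all strict, because forms
    containing D but not p + D exist. *)
Lemma dim_along_eq D d : (size D <= d)%N -> \dim {:Defs.form L w d} = (\dim (alongv D d) + size D)%N.
Proof.
elim: D => [|p D IH] Dd; first by rewrite alongv_nil addn0.
rewrite IH; last exact: ltnW.
rewrite /= addnS -addSn; congr (_ + _)%N; apply/anti_leq; rewrite dim_along_cons /=.
have sub : (alongv (p :: D) d <= alongv D d)%VS.
  by apply/subvP => f /alongvP /along_cons a; apply/alongvP.
rewrite (ltn_leqif (dimv_leqif_sup sub)); apply/subvPn.
have [F [/formP[f ->] aF oF]] := exact_form_up p (ltnW Dd).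
exists f; first exact/alongvP.
apply/negP => /alongvP/(_ p); rewrite /= eqxx add1n => /(ord_eq_ge (form_homog f) oF).
by rewrite ltnn.
Qed.

End Orders.

(** * Bezout's theorem *)

Section Bezout.

Variables (L : closedFieldType) (w : nat) (C : curve L w).
Local Notation P := {mpoly L[w.+1]}.
Local Notation pt := {p : ppoint L w | p \in curve_set C}.
Implicit Types (F G H : P) (p q : pt) (D E : seq pt).
Variable t : pt -> P.
Hypothesis tP : forall p, local_parameter p (t p).

(** The Hilbert function of C: the dimension of the degree N part of its homogeneous
    coordinate ring. *)
Definition hilb N := (\dim {:Defs.form L w N} - \dim (van_space C N))%N.

Lemma hilbE N : \dim {:Defs.form L w N} = (hilb N + \dim (van_space C N))%N.
Proof. by rewrite subnK // dimvS // subvf. Qed.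

(** Multiplication by F embeds the forms of degree N modulo C into the forms of degree
    N + e containing D, of codimension |D|. *)
Lemma hilb_step D e F N : F \is e.-homog -> ~ van C F -> along t D e F ->
  (size D <= N + e)%N -> (hilb N + size D <= hilb (N + e))%N.
Proof.
move=> hF nF aF DN.
pose rho (f : Defs.form L w N) (g : Defs.form L w (N + e)) := (g : P) = (f : P) * F.
have := @rel_dim L _ _ rho (van_space C N) (alongv t D (N + e)) (van_space C (N + e)).
rewrite (hilbE N) => le.
have {le} : (hilb N + \dim (van_space C N) + \dim (van_space C (N + e)) <=
   \dim (alongv t D (N + e)) + \dim (van_space C N))%N.
  apply: le => [|a f f' g g'|f|f g /van_spaceP vg fg|]; rewrite /rho.
  - by rewrite !form0 mul0r.
  - by rewrite !formZD => -> ->; rewrite mulrDl scalerAl.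
  - have [g Eg] := formP (dhomogM (form_homog f) hF).
    exists g => //; apply/alongvP => //; rewrite -Eg => p.
    rewrite -[count_mem _ _]add0n; apply: ord_geM => //.
    exact/ord_ge0/form_homog.
  - apply/van_spaceP; have : van C ((f : P) * F) by rewrite -fg.
    by case/(van_mul (form_homog f) hF).
  - exact: alongv_van.
have := dim_along_eq tP DN; rewrite (hilbE (N + e)); lia.
Qed.

Lemma hilb_iter D e F N k : F \is e.-homog -> ~ van C F -> along t D e F ->
  (size D <= N)%N -> (hilb N + k * size D <= hilb (N + k * e))%N.
Proof.
move=> hF nF aF DN; elim: k => [|k IH]; first by rewrite !mul0n !addn0.
have := hilb_step hF nF aF (N := (N + k * e)%N).
rewrite -addnA -mulSnr => /(_ (leq_trans DN (leq_addr _ _))).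
by apply: leq_trans; rewrite mulSnr addnA leq_add2r.
Qed.

(** By iteration k |D| is at most h(|D| + k e), which grows like c k e; so |D| <= c e. *)
Lemma along_bounded e F : F \is e.-homog -> ~ van C F ->
  exists B, forall D, along t D e F -> (size D <= B)%N.
Proof.
move=> hF nF; have [c grow] := hilbert_growth C.
have hg N : (hilb N <= c * N.+1)%N by have := grow N; rewrite hilbE leq_add2r.
exists (c * e)%N => D aF; rewrite leqNgt; apply/negP => lt.
(* k exceeds the constant term of the bound c (|D| + k e + 1) *)
pose k := (c * (size D).+1).+1.
have := hilb_iter k hF nF aF (leqnn _).
have := hg (size D + k * e)%N.
have : (k * (c * e).+1 <= k * size D)%N by rewrite leq_mul2l lt orbT.
have -> : (c * (size D + k * e).+1 = c * (size D).+1 + k * (c * e))%N by nia.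
rewrite mulnS; rewrite {1 3}/k; lia.
Qed.

Definition divisor_of D e F := forall p, ord_eq t p (count_mem p D) e F.

(** A longest list of points contained in F records all orders of vanishing
    exactly. *)
Lemma divisor_exists e F : F \is e.-homog -> ~ van C F -> exists D, divisor_of D e F.
Proof.
move=> hF nF; have [B bound] := along_bounded hF nF.
pose good n := `[< exists2 D, size D = n & along t D e F >].
have ex : exists n, good n.
  by exists 0%N; apply/asboolP; exists [::] => // p; apply: ord_ge0.
have ub n : good n -> (n <= B)%N by move=> /asboolP[D <- /bound].
case: (ex_maxnP ex ub) => n /asboolP[D sD aF] nmax.
exists D => p; case: (ord_ge_or_eq tP (aF p)) => // o.
have /nmax : good (size (p :: D)).
  by apply/asboolP; exists (p :: D) => //; apply: along_consP.
by rewrite /= sD ltnn.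
Qed.

Lemma divisor_cat D E d e F G : divisor_of D d F -> divisor_of E e G ->
  divisor_of (D ++ E) (d + e) (F * G).
Proof. by move=> oF oG p; rewrite count_cat; apply: ord_eqM. Qed.

Lemma divisor_exp D d F k : divisor_of D d F ->
  divisor_of (flatten (nseq k D)) (d * k) (F ^+ k).
Proof.
move=> oF p; have -> : count_mem p (flatten (nseq k D)) = (count_mem p D * k)%N.
  by rewrite count_flatten map_nseq sumn_nseq.
exact: ord_eqX.
Qed.

(** Let J be the ideal of denominators of r = f / F, consisting of the H with H r
    again a form on C. At each point of C the function r is regular, so J has no
    zeros and by the Nullstellensatz contains all forms of some degree N. Then r
    acts on the forms of degree N modulo C, and an eigenvector v gives
    (r - a) v = 0 on C, whence r = a. *)
Lemma regular_constant D e F f : F \is e.-homog -> ~ van C F -> divisor_of D e F ->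
  f \is e.-homog -> along t D e f -> exists a, forall q, ev f q = a * ev F q.
Proof.
move=> hF nF oF hf af.
pose J d H := H \is d.-homog /\ exists2 G, G \is d.-homog &
  forall q, ev H q * ev f q = ev G q * ev F q.
have iJ : graded_ideal J.
  split.
  - by move=> d H [].
  - move=> d; split; first exact: dhomog0.
    by exists 0; [exact: dhomog0 | move=> q; rewrite !meval0 !mul0r].
  - move=> d H H' [hH [G hG E]] [hH' [G' hG' E']]; split; first exact: rpredD.
    by exists (G + G'); [exact: rpredD | move=> q; rewrite !mevalD !mulrDl E E'].
  move=> d k H K [hH [G hG E]] hK; split; first exact: dhomogM.
  by exists (K * G); [exact: dhomogM | move=> q; rewrite !mevalM -!mulrA E].
have JI d H : H \is d.-homog -> van C H -> J d H.
  move=> hH vH; split=> //; exists 0; first exact: dhomog0.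
  by move=> q; rewrite vH meval0 !mul0r.
have [N full] : exists N, forall H, H \is N.-homog -> J N H.
  apply: contrapT => nfull; have pJ : gi_proper J.
    move=> N; apply: contrapT => nN; apply: nfull; exists N => H hH.
    by apply: contrapT => nH; apply: nN; exists H.
  have [x xJ] := projective_nullstellensatz iJ pJ.
  have xC : x \in curve_set C.
    have [T TP] := curve_closed C; apply/TP => d H TH; apply: (xJ d).
    apply: JI; first exact: form_homog.
    by move=> q; have /TP := valP q; apply.
  pose p : pt := exist _ x xC.
  have [g' [m' [k' [h' [hh' hg' mk' hp' E']]]] gp'] := oF p.
  have [g [m [k [h [hh hg mk hp E]]]]] := af p.
  have /xJ : J (k' + m)%N (g' * h).
    split; first exact: dhomogM.
    exists (g * h'); first by have -> : (k' + m = k + m')%N by [lia]; apply: dhomogM.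
    move=> q; rewrite !mevalM.
    transitivity (ev g' q * (ev h q * ev f q)); first by ring.
    rewrite E; transitivity (ev g q * (ev h' q * ev F q)); last by ring.
    by rewrite E'; ring.
  by move/eqP; rewrite -[x]/(val p) mevalM mulf_eq0 (negPf gp') (negPf hp).
have [i nXi] := nonvan_var C.
pose rho (h h' : Defs.form L w N) := forall q, ev h q * ev f q = ev h' q * ev F q.
have [||v||a [v [u [vI uI r]]]] := @rel_eigenvector L _ (van_space C N) rho.
- by move=> q; rewrite form0 !meval0 !mul0r.
- by move=> a v v' g g' r r' q; rewrite !formZD !mevalD !mevalZ !mulrDl -!mulrA r r'.
- have [_ [G hG E]] := full _ (form_homog v); have [g Eg] := formP hG.
  by exists g => q; rewrite -Eg.
- apply/eqP => full_van; apply: (nonvan_exp (n := N) (homogX L i) nXi).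
  have [g Eg] := formP (homogXn L i N); rewrite Eg; apply/van_spaceP.
  by rewrite full_van memvf.
exists a; move/van_spaceP : uI => vu.
have hfa : f - a *: F \is e.-homog by apply: rpredB => //; apply: rpredZ.
have : van C ((v : P) * (f - a *: F)).
  move=> q; have := r q; rewrite formZD mevalD vu addr0 mevalM mevalB !mevalZ => E.
  rewrite mulrBr E; ring.
case/(van_mul (form_homog v) hfa) => [/van_spaceP|vf q]; first by rewrite (negPf vI).
by have /eqP := vf q; rewrite mevalB mevalZ subr_eq0 => /eqP.
Qed.

(** Containing D imposes at most |D| conditions, and leaves only the multiples of F. *)
Lemma hilb_le_divisor D e F : F \is e.-homog -> ~ van C F -> divisor_of D e F ->
  (hilb e <= (size D).+1)%N.
Proof.
move=> hF nF oF; have [f Ef] := formP hF.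
have sub : (alongv t D e <= van_space C e + <[f]>)%VS.
  apply/subvP => g /alongvP ag.
  have [a E] := regular_constant hF nF oF (form_homog g) ag.
  rewrite -[g](subrK (a *: f)) memv_add ?memvZ ?memv_line //; apply/van_spaceP => q.
  have -> : ((g - a *: f : Defs.form L w e) : P) = (g : P) - a *: (f : P) by [].
  by rewrite mevalB mevalZ E -Ef subrr.
have := dimvS sub; have := dim_along_le tP D e; rewrite hilbE.
have := leq_of_leqif (dimv_add_leqif (van_space C e) <[f]>); rewrite dim_vline.
by case: (f != 0); lia.
Qed.

(** Here k |D| <= h((e + 1)(c + k)) <= (c + k) |E| + 1 for every k, with c = |D|; the
    coefficients of k on both sides are compared. *)
Lemma divisor_size_le D E e F G : F \is e.+1.-homog -> G \is e.+1.-homog ->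
  ~ van C F -> ~ van C G -> divisor_of D e.+1 F -> divisor_of E e.+1 G ->
  (size D <= size E)%N.
Proof.
move=> hF hG nF nG oF oG; rewrite leqNgt; apply/negP => lt.
(* k exceeds the constant term of the bound (c + k) |E| + 1 *)
pose c := size D; pose k := (c * size E).+2.
have aF : along t D e.+1 F by move=> p; apply: ord_eqW.
have le1 : (size D <= e.+1 * c)%N by rewrite /c leq_pmull.
have := hilb_iter k hF nF aF le1.
have -> : (e.+1 * c + k * e.+1 = e.+1 * (c + k))%N by rewrite mulnDr [(k * _)%N]mulnC.
have := hilb_le_divisor (homog_exp (c + k) hG) (nonvan_exp (n := (c + k)%N) hG nG)
  (divisor_exp (c + k) oG).
rewrite size_flatten /shape map_nseq sumn_nseq.
have : (k * (size E).+1 <= k * size D)%N by rewrite leq_mul2l lt orbT.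
have -> : (size E * (c + k) = c * size E + k * size E)%N by rewrite mulnDr mulnC [(size E * k)%N]mulnC.
rewrite mulnS {1 6}/k; lia.
Qed.

(** Comparison of F 'X_i with 'X_i^(e+1), which have the same positive degree, also
    covers e = 0. *)
Theorem degree_of_sections : exists m, forall e F D, F \is e.-homog -> ~ van C F ->
  divisor_of D e F -> size D = (e * m)%N.
Proof.
have [i nXi] := nonvan_var C; have hX := homogX L i.
have [M oM] := divisor_exists hX nXi.
exists (size M) => e F D hF nF oF.
have hF1 : F * 'X_i \is e.+1.-homog by have := dhomogM hF hX; rewrite addn1.
have oF1 : divisor_of (D ++ M) e.+1 (F * 'X_i) by have := divisor_cat oF oM; rewrite addn1.
have nF1 := nonvan_mul hF hX nF nXi.
have hX1 : 'X_i ^+ e.+1 \is e.+1.-homog := homogXn L i e.+1.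
have oX1 := divisor_exp e.+1 oM; rewrite mul1n in oX1.
have nX1 := nonvan_exp (n := e.+1) hX nXi.
have := divisor_size_le hF1 hX1 nF1 nX1 oF1 oX1.
have := divisor_size_le hX1 hF1 nX1 nF1 oX1 oF1.
rewrite size_flatten /shape map_nseq sumn_nseq size_cat; lia.
Qed.

End Bezout.

(** * Linear equivalence *)

Section Translation.

Variables (L : closedFieldType) (w : nat) (C : curve L w).
Local Notation P := {mpoly L[w.+1]}.
Local Notation pt := {p : ppoint L w | p \in curve_set C}.
Implicit Types (F G H : P) (p q : pt) (D E : seq pt).
Variable t : pt -> P.
Hypothesis tP : forall p, local_parameter p (t p).

Lemma eq_gen_off d F (h1 h2 : ppoint L w -> L) : F \is d.-homog -> ~ van C F ->
  (forall q, ev F q != 0 -> h1 (val q) = h2 (val q)) -> eq_gen C h1 h2.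
Proof.
move=> hF nF E; have [cZ pZ] := proper_closed_zeros hF nF.
exists ([pred x | F.@[pcoord x] == 0] : pred _); split=> // x xC; rewrite inE => Fx.
exact: (E (exist _ x xC)).
Qed.

(** Two forms agree on C as soon as they agree on the open set where h1 = h2 and the
    denominators, collected in T, are non-zero. *)
Lemma eq_gen_cross (h1 h2 : ppoint L w -> L) d e F G T :
  eq_gen C h1 h2 -> F \is d.-homog -> G \is d.-homog -> T \is e.-homog -> ~ van C T ->
  (forall q, ev T q != 0 -> h1 (val q) = h2 (val q) -> ev F q = ev G q) ->
  forall q, ev F q = ev G q.
Proof.
move=> [Z [cZ pZ hZ]] hF hG hT nT FG.
apply: (generic_eq (proper_closedU (conj cZ pZ) (proper_closed_zeros hT nT)) hF hG).
move=> q; rewrite !inE negb_or => /andP[qZ Tq]; apply: FG => //.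
by apply: hZ => //; exact: valP.
Qed.

Lemma ev_mul_neq0 F G q : ev (F * G) q != 0 -> ev F q != 0 /\ ev G q != 0.
Proof. by rewrite mevalM mulf_eq0 negb_or => /andP. Qed.

Lemma ev_mulX F G H k q : ev (F * (G * H ^+ k)) q = ev F q * (ev G q * ev H q ^+ k).
Proof. by rewrite !mevalM rmorphXn. Qed.

Lemma nonvan_den (f : ratfun C) : ~ van C (rden f).
Proof. by move/vanP; case: f. Qed.

Lemma ratfunP d F G : F \is d.-homog -> G \is d.-homog -> ~ van C G ->
  exists f : ratfun C, [/\ (rnum f : P) = F, (rden f : P) = G & rdeg f = d].
Proof.
move=> hF hG nG.
have nx : ~ vanishes_on C (DHomog hG : Defs.form L w d) by move/vanP.
by exists (RatFun (DHomog hF : Defs.form L w d) nx).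
Qed.

Lemma rvalE (f : ratfun C) q : f (val q) = ev (rnum f) q / ev (rden f) q.
Proof. by []. Qed.

Lemma nonvan_at F p : ev F p != 0 -> ~ van C F.
Proof. by move=> Fp vF; rewrite vF eqxx in Fp. Qed.

(** For a function with numerator F vanishing at p, dividing the local relation
    h F = g t by h, by 'X_i and by the denominator, all non-zero at p, exhibits the
    function as a multiple of t / 'X_i. *)
Lemma standard_uniformizer p i : pcoord (val p) i = 1 -> exists f : ratfun C,
  [/\ (rnum f : P) = t p, (rden f : P) = 'X_i & uniformizer (val p) f].
Proof.
move=> pi; have Xp : ev 'X_i p != 0 by rewrite mevalXU pi oner_neq0.
have nX := nonvan_at Xp.
have [_ tp0 nt loc] := tP p.
have [f [nf df _]] := ratfunP (homog_t tP p) (homogX L i) nX.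
exists f; split=> //; split; first by rewrite /feval df.
  by rewrite rvalE nf tp0 mul0r.
move=> u du0 up0.
have up : ev (rnum u) p = 0.
  by have /eqP := up0; rewrite rvalE mulf_eq0 invr_eq0 (negPf (du0 : ev (rden u) p != 0)) orbF => /eqP.
have [m [h [g [hh hg hp E]]]] := loc _ _ (form_homog (rnum u)) up.
have nh := nonvan_at hp; have hD := form_homog (rden u); have nD := nonvan_den (f := u).
have h1 : g * 'X_i \is (m.+1 + rdeg u)%N.-homog.
  by have := dhomogM hg (homogX L i); rewrite addn1.
have h2 := dhomogM hh hD; have n2 := nonvan_mul hh hD nh nD.
have [v [nv dv _]] := ratfunP h1 h2 n2.
exists v; first by rewrite /feval dv mevalM mulf_neq0.
apply: (eq_gen_off (dhomogM h2 (homogX L i)) (nonvan_mul h2 (homogX L i) n2 nX)) => q.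
rewrite !rvalE nv dv nf df !mevalM !mulf_eq0 !negb_or => /andP[/andP[hq Dq] Xq].
apply: (mulfI hq); rewrite mulrA E; field.
by rewrite Xq Dq hq.
Qed.

(** The standard uniformizer t / 'X_i is a multiple g f of f with g regular, so f
    cannot vanish to order 2 at p. *)
Lemma ord_of_uniformizer p (f : ratfun C) : uniformizer (val p) f ->
  ord_eq t p 1 (rdeg f) (rnum f).
Proof.
move=> [df0 fp uf]; have [i pi] := coord_unit (val p).
have Xp : ev 'X_i p != 0 by rewrite mevalXU pi oner_neq0.
have nX := nonvan_at Xp; have hX := homogX L i.
have hN := form_homog (rnum f); have hD := form_homog (rden f).
have [s [ns ds [ds0 sp _]]] := standard_uniformizer pi.
have [g dg0 gen] := uf s ds0 sp.
have hgN := form_homog (rnum g); have hgD := form_homog (rden g).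
have h1 := dhomogM (homog_t tP p) (dhomogM hgD hD).
have h2 : (rnum g : P) * rnum f * 'X_i \is (1 + (rdeg g + rdeg f))%N.-homog.
  by rewrite addnC; exact: (dhomogM (dhomogM hgN hN) hX).
have hT := dhomogM (dhomogM hgD hD) hX.
have nT := nonvan_mul (dhomogM hgD hD) hX (nonvan_mul hgD hD (nonvan_den (f:=g)) (nonvan_den (f:=f))) nX.
have E := eq_gen_cross gen h1 h2 hT nT.
have {}E : forall q, ev (t p * ((rden g : P) * rden f)) q = ev ((rnum g : P) * rnum f * 'X_i) q.
  apply: E => q; rewrite !rvalE ns ds !mevalM !mulf_eq0 !negb_or => /andP[/andP[gq fq] Xq] E.
  transitivity (ev (t p) q / ev 'X_i q * (ev 'X_i q * ev (rden g) q * ev (rden f) q)).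
    by field.
  rewrite E; field; by rewrite fq gq.
have fp0 : ev (rnum f) p = 0.
  by have /eqP := fp; rewrite rvalE mulf_eq0 invr_eq0 (negPf (df0 : ev (rden f) p != 0)) orbF => /eqP.
have [//|o2] := ord_ge_or_eq tP (ord_ge1 tP hN fp0).
have o1 : ord_eq t p (1 + (0 + 0)) (1 + (rdeg g + rdeg f)) (t p * ((rden g : P) * rden f)).
  by apply: ord_eqM; [exact: ord_eq_t | apply: ord_eqM; apply: ord_eq0].
have := ord_geM (ord_geM (ord_ge0 t p hgN) o2) (ord_ge0 t p hX).
rewrite [X in ord_ge _ _ _ X]addnC => /(ord_ge_ext (fun q => esym (E q))).
by move/(ord_eq_ge tP h1 o1).
Qed.

Lemma ord_eq_exists p d F : F \is d.-homog -> ~ van C F -> exists n, ord_eq t p n d F.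
Proof. by move=> hF nF; have [D oD] := divisor_exists tP hF nF; exists (count_mem p D). Qed.

(** After clearing denominators, h = u s^n becomes an identity between forms, and
    orders are additive. *)
Lemma ord_at_inv p (h : ppoint L w -> L) (n : int) d F G : F \is d.-homog -> G \is d.-homog ->
  ~ van C G -> (forall q, h (val q) = ev F q / ev G q) -> ord_at C (val p) h n ->
  exists n1 n2, [/\ ord_eq t p n1 d F, ord_eq t p n2 d G & n = n1%:Z - n2%:Z].
Proof.
move=> hF hG nG hE [s [u [us du0 up gen]]].
have [n2 o2] := ord_eq_exists p hG nG.
have os := ord_of_uniformizer us; have [ds0 _ _] := us.
have hsN := form_homog (rnum s); have hsD := form_homog (rden s).
have huN := form_homog (rnum u); have huD := form_homog (rden u).
have nsN : ~ van C (rnum s) by apply: ord_eq_nonvan os.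
have nsD := nonvan_den (f := s); have nuD := nonvan_den (f := u).
have osD := ord_eq0 t hsD (ds0 : ev (rden s) p != 0).
have ouD := ord_eq0 t huD (du0 : ev (rden u) p != 0).
have uN0 : ev (rnum u) p != 0.
  by move: up; rewrite rvalE mulf_eq0 negb_or => /andP[].
have ouN := ord_eq0 t huN uN0.
have hT := dhomogM hG (dhomogM huD (dhomogM hsN hsD)).
have nT := nonvan_mul hG (dhomogM huD (dhomogM hsN hsD)) nG
  (nonvan_mul huD (dhomogM hsN hsD) nuD (nonvan_mul hsN hsD nsN nsD)).
(* F (uD a^k) = G (uN b^k) where (a, b) are the denominator and numerator of s,
   or the reverse when n is negative *)
have main (a b : P) k na nb : a \is (rdeg s).-homog -> b \is (rdeg s).-homog ->
    ord_eq t p na (rdeg s) a -> ord_eq t p nb (rdeg s) b ->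
    (forall q, ev (rnum s) q != 0 -> ev (rden s) q != 0 ->
       s (val q) ^ n = ev b q ^+ k / ev a q ^+ k /\ ev a q != 0) ->
    exists2 n1, ord_eq t p n1 d F & (n1 + na * k = n2 + nb * k)%N.
  move=> ha hb oa ob sE.
  have h1 := dhomogM hF (dhomogM huD (homog_exp k ha)).
  have h2 := dhomogM hG (dhomogM huN (homog_exp k hb)).
  have E : forall q, ev (F * ((rden u : P) * a ^+ k)) q = ev (G * ((rnum u : P) * b ^+ k)) q.
    have cross := eq_gen_cross gen h1 h2 hT nT; apply: cross => q.
    move=> /ev_mul_neq0[Gq /ev_mul_neq0[uq /ev_mul_neq0[sNq sDq]]].
    have [-> aq] := sE q sNq sDq; rewrite hE rvalE => E.
    rewrite [LHS]ev_mulX [RHS]ev_mulX; move: E.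
    have := expf_neq0 k aq; set x := _ ^+ k; set y := _ ^+ k => x0 E.
    transitivity (ev F q / ev G q * (ev G q * ev (rden u) q * x)); first by field.
    by rewrite E; field; rewrite uq x0.
  have oR := ord_eqM o2 (ord_eqM ouN (ord_eqX k ob)).
  have nR := ord_eq_nonvan tP h2 oR.
  have nF : ~ van C F by move=> vF; apply: nR => q; rewrite -E mevalM vF mul0r.
  have [n1 o1] := ord_eq_exists p hF nF; exists n1 => //.
  have oL := ord_eqM o1 (ord_eqM ouD (ord_eqX k oa)).
  have oL' : ord_eq t p (n1 + (0 + na * k)) (d + (rdeg u + rdeg s * k)) (G * ((rnum u : P) * b ^+ k)).
    exact: ord_eq_ext E oL.
  exact: (ord_eq_unique tP h2 oL' oR).
clear hT nT; case: n gen main => k _ main.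
  have [|n1 o1 e] := main (rden s) (rnum s) k 0%N 1%N hsD hsN osD os.
    by move=> q sN sD; split; [rewrite rvalE -exprnP expr_div_n | exact: sD].
  exists n1, n2; split; [exact: o1 | exact: o2 |].
  by clear -e; lia.
have [|n1 o1 e] := main (rnum s) (rden s) k.+1 1%N 0%N hsN hsD os osD.
  move=> q sN sD; split; last exact: sN.
  by rewrite rvalE NegzE -exprz_inv invf_div -exprnP expr_div_n.
exists n1, n2; split; [exact: o1 | exact: o2 |].
by clear -e; lia.
Qed.

(** If h1 F = f t^n1 and h2 G = g t^n2, then F / G = u (t / 'X_i)^(n1 - n2) with the unit
    u = f h2 'X_i^n1 / (h1 g 'X_i^n2); the powers of 'X_i make its degree zero. *)
Lemma ord_at_intro p (h : ppoint L w -> L) d F G n1 n2 : F \is d.-homog -> G \is d.-homog ->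
  (forall q, h (val q) = ev F q / ev G q) ->
  ord_eq t p n1 d F -> ord_eq t p n2 d G -> ord_at C (val p) h (n1%:Z - n2%:Z).
Proof.
move=> hF hG hE [f [m1 [k1 [h1 [hh1 hf mk1 h1p E1]]]] fp] [g [m2 [k2 [h2 [hh2 hg mk2 h2p E2]]]] gp].
have [i pi] := coord_unit (val p); have hX := homogX L i.
have Xp : ev 'X_i p != 0 by rewrite mevalXU pi oner_neq0.
have nX := nonvan_at Xp.
have [s [ns ds us]] := standard_uniformizer pi.
have hN := dhomogM (dhomogM hf hh2) (homogXn L i n1).
have hD : h1 * g * 'X_i ^+ n2 \is (k1 + m2 + n1)%N.-homog.
  have -> : (k1 + m2 + n1 = m1 + k2 + n2)%N by [clear -mk1 mk2; lia].
  exact: (dhomogM (dhomogM hh1 hg) (homogXn L i n2)).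
have Dp : ev (h1 * g * 'X_i ^+ n2) p != 0.
  by rewrite !mevalM rmorphXn /= !mulf_neq0 // expf_neq0.
have [u [nu du _]] := ratfunP hN hD (nonvan_at Dp).
exists s, u; split=> //; first by rewrite /feval du.
  rewrite rvalE nu du mulf_neq0 ?invr_eq0 // !mevalM rmorphXn /= !mulf_neq0 //.
  by rewrite expf_neq0.
have hT := dhomogM (dhomogM hh1 hh2) (dhomogM hg (dhomogM (homog_t tP p) hX)).
have nt := nonvan_t tP (p := p).
have nT : ~ van C (h1 * h2 * (g * (t p * 'X_i))).
  have nv := nonvan_at.
  apply: (nonvan_mul (dhomogM hh1 hh2)); first exact: (dhomogM hg (dhomogM (homog_t tP p) hX)).
    by apply: (nonvan_mul hh1 hh2); [exact: nv _ _ h1p | exact: nv _ _ h2p].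
  apply: (nonvan_mul hg (dhomogM (homog_t tP p) hX)); first exact: nv _ _ gp.
  exact: (nonvan_mul (homog_t tP p) hX).
apply: (eq_gen_off hT nT) => q; rewrite !mevalM !mulf_eq0 !negb_or.
move=> /andP[/andP[h1q h2q] /and3P[gq tq Xq]].
have s0 : s (val q) != 0 by rewrite rvalE ns ds mulf_neq0 ?invr_eq0.
rewrite expfzDr // -exprnP -invr_expz -exprnP hE !rvalE ns ds nu du !mevalM !rmorphXn /=.
have F_E : ev F q = ev f q * ev (t p) q ^+ n1 / ev h1 q.
  by rewrite -E1 mulrAC mulfV // mul1r.
have G_E : ev G q = ev g q * ev (t p) q ^+ n2 / ev h2 q.
  by rewrite -E2 mulrAC mulfV // mul1r.
rewrite F_E G_E !expr_div_n.
have := expf_neq0 n1 Xq; have := expf_neq0 n2 Xq; have := expf_neq0 n2 tq.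
set a := _ ^+ n2; set b := _ ^+ n2; set c := _ ^+ n1 => a0 b0 c0.
by field; rewrite gq h1q h2q a0 b0 c0.
Qed.

Lemma inter_multP p e (phi : Defs.form L w e) (n : int) :
  inter_mult C (val p) phi n <-> exists2 k, ord_eq t p k e phi & n = k%:Z.
Proof.
split=> [[l lp o]|[k o ->]].
  have hl := form_homog l; have hle := homog_exp e hl; rewrite mul1n in hle.
  have nl := nonvan_at (lp : ev l p != 0).
  have [|n1 [n2 [o1 o2 ->]]] := ord_at_inv (form_homog phi) hle (nonvan_exp (n := e) hl nl) _ o.
    by move=> q; rewrite rmorphXn.
  exists n1 => //; have := ord_eq_unique tP hle o2 (ord_eq0 t hle _).
  by move=> ->; [rewrite subr0 | rewrite rmorphXn /= expf_neq0].
have [i pi] := coord_unit (val p); have hX := homogX L i.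
have Xp : ev 'X_i p != 0 by rewrite mevalXU pi oner_neq0.
exists (DHomog hX) => //; rewrite -[k%:Z]subr0 -[0]/(0%:Z).
apply: (ord_at_intro (form_homog phi) (homogXn L i e)) o _.
  by move=> q; rewrite rmorphXn.
by apply: ord_eq0; [exact: homogXn | rewrite rmorphXn /= expf_neq0].
Qed.

Local Notation wset := {freeg pt / int}.

Definition wset_of D : wset := \sum_(p <- D) << p >>.

Lemma coeff_wset_of D p : coeff p (wset_of D) = (count_mem p D)%:Z.
Proof.
rewrite /wset_of; elim: D => [|q D IH]; first by rewrite big_nil coeff0.
by rewrite big_cons coeffD IH coeffU mul1r /= PoszD; case: eqP.
Qed.

Lemma deg_wset_of D : deg (wset_of D) = (size D)%:Z.
Proof.
rewrite /wset_of; elim: D => [|q D IH]; first by rewrite big_nil deg0.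
by rewrite big_cons degD IH degU /= -add1n PoszD.
Qed.

Lemma wset_eq (A B : wset) : (forall p, coeff p A = coeff p B) -> A = B.
Proof. by move=> E; apply/eqP/freeg_eqP. Qed.

Lemma wset_of_cat D E : wset_of (D ++ E) = wset_of D + wset_of E.
Proof. exact: big_cat. Qed.

Lemma effective_sub D E : (forall p, count_mem p E <= count_mem p D)%N ->
  effective (wset_of D - wset_of E).
Proof. by move=> le p; rewrite coeffB !coeff_wset_of subr_ge0 lez_nat; apply: le. Qed.

(** Each point of the support is repeated as often as its coefficient says. *)
Lemma effective_wset_of (A : wset) : effective A -> exists D, A = wset_of D.
Proof.
move=> eA; rewrite -(freeg_sumE A).
elim: (dom A) => [|q s [D IH]]; first by exists [::]; rewrite big_nil /wset_of big_nil.
exists (nseq `|coeff q A|%N q ++ D); rewrite big_cons IH; apply: wset_eq => p.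
rewrite coeffD !coeff_wset_of coeffU count_cat PoszD; congr (_ + _).
by rewrite count_nseq /=; case: eqP => _; rewrite ?mulr1 ?mul1n ?mulr0 // gez0_abs.
Qed.

Lemma finite_inter_nonvan e (phi : Defs.form L w e) : finite_inter C phi -> ~ van C phi.
Proof.
move=> [s sP] v; have [q /negP] := curve_infinite C s; apply.
by apply: sP; [exact: valP | exact: v].
Qed.

(** The divisor exists because a form with finite intersection cannot vanish on the
    infinite set C. *)
Lemma cutsP e (phi : Defs.form L w e) (W : wset) :
  cuts phi W <-> exists2 D, divisor_of t D e phi & W = wset_of D.
Proof.
have hphi := form_homog phi.
split=> [[fin mult]|[D oD ->]].
  have [D oD] := divisor_exists tP hphi (finite_inter_nonvan fin).
  exists D => //; apply: wset_eq => p; rewrite coeff_wset_of.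
  have /inter_multP[k ok ->] := mult p.
  by rewrite (ord_eq_unique tP hphi ok (oD p)).
split; last by move=> p; apply/inter_multP; exists (count_mem p D); rewrite ?coeff_wset_of.
exists (map val D) => x xC phix; pose p : pt := exist _ x xC.
rewrite -[x]/(val p) mem_map; last exact: val_inj.
rewrite -has_pred1 has_count.
exact: (ord_eq_ge tP hphi (oD p) (ord_ge1 tP hphi (phix : ev phi p = 0))).
Qed.

Lemma curve_degree_exists : exists m, curve_degree C m /\
  forall e F D, F \is e.-homog -> ~ van C F -> divisor_of t D e F -> size D = (e * m)%N.
Proof.
have [m mP] := degree_of_sections tP; exists m; split=> // l fl.
have nl := finite_inter_nonvan fl; have hl := form_homog l.
have [D oD] := divisor_exists tP hl nl; exists (wset_of D); first by apply/cutsP; exists D.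
by rewrite deg_wset_of (mP _ _ _ hl nl oD) mul1n.
Qed.

Lemma ratfun_nonzero (g : ratfun C) : ~ eq_gen C g (fun=> 0) <-> ~ van C (rnum g).
Proof.
have hN := form_homog (rnum g); have hD := form_homog (rden g).
split=> ng; first move=> v; last move=> gen; apply: ng.
  apply: (eq_gen_off hD (nonvan_den (f := g))) => q _.
  by rewrite rvalE v mul0r.
move=> q; rewrite -(meval0 (pcoord (val q)) (R := L)); move: q.
apply: (eq_gen_cross gen hN (dhomog0 L mdeg _) hD (nonvan_den (f := g))) => q Dq.
by rewrite rvalE meval0 => /eqP; rewrite mulf_eq0 invr_eq0 (negPf Dq) orbF => /eqP.
Qed.

Lemma series_dim_exists e (S : {vspace Defs.form L w e}) : S != 0%VS -> exists r, series_dim C S r.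
Proof.
move=> S0; pose good r := `[< series_cut_by C S r >].
have ex : exists r, good r.
  exists (\dim S).-1; apply/asboolP; exists S; split=> //; rewrite prednK //.
  by rewrite lt0n dimv_eq0.
case: (ex_minnP ex) => r /asboolP gr rmin; exists r; split=> // r' gr'.
by apply: rmin; apply/asboolP.
Qed.

(** If A1 + B2 = W1 - W0 and B1 + A2 = W2 - W0 with W1 and W2 cut out by phi1 and phi2,
    then A - B = W1 - W2 is the divisor of phi1 / phi2. *)
Lemma lin_equiv_div (A B : wset) : lin_equiv A B ->
  exists2 g : ratfun C, ~ eq_gen C g (fun=> 0) & is_div g (A - B).
Proof.
move=> [_ [n [r [G [_ _ _ gnr [GA GB]]]]]].
have [e [S [W0 [m [_ _ _ _ GP]]]]] := gnr.
have /GP[W1 [phi1 _ /cutsP[D1 o1 eW1]] E1] := GA.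
have /GP[W2 [phi2 _ /cutsP[D2 o2 eW2]] E2] := GB.
have h1 := form_homog phi1; have h2 := form_homog phi2.
have [p0 _] := curve_infinite C [::].
have n1 := ord_eq_nonvan tP h1 (o1 p0); have n2 := ord_eq_nonvan tP h2 (o2 p0).
have [g [ng dg _]] := ratfunP h1 h2 n2.
exists g; first by apply/ratfun_nonzero; rewrite ng.
have AB : A - B = wset_of D1 - wset_of D2.
  have eq1 : W1 = fgpos A + fgneg B + W0 by rewrite E1 subrK.
  have eq2 : W2 = fgpos B + fgneg A + W0 by rewrite E2 subrK.
  rewrite -eW1 -eW2 eq1 eq2 {1}(fg_decomp A) {1}(fg_decomp B).
  by apply: wset_eq => p; rewrite !(coeffB, coeffD); ring.
move=> p; rewrite AB coeffB !coeff_wset_of.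
apply: (ord_at_intro h1 h2 _ (o1 p) (o2 p)) => q.
by rewrite rvalE ng dg.
Qed.

(** The auxiliary form H contains A1 + B2, which makes W0 = div(FH) - (A1 + B2)
    effective. A member a FH + b GH of the pencil vanishes at p at least to the
    smaller of the orders of FH and GH, and these exceed W0 by the multiplicities
    of A1 + B2 and of B1 + A2 at p. *)
Lemma div_lin_equiv (A B : wset) (degAB : deg A = deg B) (g : ratfun C) :
  ~ eq_gen C g (fun=> 0) -> is_div g (A - B) -> lin_equiv A B.
Proof.
move=> /ratfun_nonzero nN gdiv; split=> //.
have hN := form_homog (rnum g); have hD := form_homog (rden g); have nD := nonvan_den (f := g).
have [DF oF] := divisor_exists tP hN nN; have [DG oG] := divisor_exists tP hD nD.
have pos (E : wset) p : 0 <= coeff p (fgpos E) by rewrite coeff_fgposE le_max lexx.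
have neg (E : wset) p : 0 <= coeff p (fgneg E) by rewrite coeff_fgnegE oppr_ge0 ge_min lexx.
have effA : effective (fgpos A + fgneg B) by move=> p; rewrite coeffD addr_ge0.
have effB : effective (fgpos B + fgneg A) by move=> p; rewrite coeffD addr_ge0.
have AB : (fgpos A + fgneg B) - (fgpos B + fgneg A) = A - B.
  rewrite [in RHS](fg_decomp A) [in RHS](fg_decomp B).
  by apply: wset_eq => p; rewrite !(coeffB, coeffD); ring.
have [DA eA] := effective_wset_of effA; have [DB eB] := effective_wset_of effB.
rewrite eA eB in AB effA effB *.
have cnt p : (count_mem p DF + count_mem p DB = count_mem p DG + count_mem p DA)%N.
  have [n1 [n2 [o1 o2]]] := ord_at_inv hN hD nD (rvalE g) (gdiv p).
  rewrite (ord_eq_unique tP hN o1 (oF p)) (ord_eq_unique tP hD o2 (oG p)).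
  rewrite -AB coeffB !coeff_wset_of; lia.
have szAB : size DA = size DB.
  have : deg (wset_of DA - wset_of DB) = 0 by rewrite AB degB degAB subrr.
  by rewrite degB !deg_wset_of => /eqP; rewrite subr_eq0 => /eqP[].
(* the exact order of H at a point p0 shows that H does not vanish on C *)
have [p0 _] := curve_infinite C [::].
have [H [hH aH oH0]] := exact_form tP p0 DA.
have nH := ord_eq_nonvan tP hH oH0.
have [DH oH] := divisor_exists tP hH nH.
have leH p : (count_mem p DA <= count_mem p DH)%N by exact: (ord_eq_ge tP hH (oH p) (aH p)).
pose e := (rdeg g + size DA)%N.
have [phi1 E1] := formP (dhomogM hN hH); have [phi2 E2] := formP (dhomogM hD hH).
have o1 : divisor_of t (DF ++ DH) e phi1 by rewrite -E1; apply: divisor_cat.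
have o2 : divisor_of t (DG ++ DH) e phi2 by rewrite -E2; apply: divisor_cat.
have n1 : ~ van C phi1 by rewrite -E1; apply: nonvan_mul hN hH nN nH.
pose S : {vspace Defs.form L w e} := (<[phi1]> + <[phi2]>)%VS.
have phi1S : phi1 \in S by rewrite -[phi1]addr0 memv_add ?memv_line ?mem0v.
have phi2S : phi2 \in S by rewrite -[phi2]add0r memv_add ?memv_line ?mem0v.
pose W1 := wset_of (DF ++ DH); pose W2 := wset_of (DG ++ DH).
have cut1 : cuts phi1 W1 by apply/cutsP; exists (DF ++ DH).
have cut2 : cuts phi2 W2 by apply/cutsP; exists (DG ++ DH).
pose W0 := W1 - wset_of DA.
have S0 : S != 0%VS.
  apply/eqP => S0; move: phi1S; rewrite S0 memv0 => /eqP phi10.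
  by apply: n1 => q; rewrite phi10 form0 meval0.
have [r rS] := series_dim_exists S0.
have [m [degm mP]] := curve_degree_exists.
pose GG (V : wset) := exists2 W : wset, in_series S W & V = W - W0.
exists (size DA), r, GG; split=> //.
- by rewrite !deg_wset_of szAB.
- exists e, S, W0, m; split=> //.
  + by exists phi1 => //; case: cut1.
  + split=> [|W [phi phiS /cutsP[D oD ->]]].
      by apply: effective_sub => p; rewrite count_cat (leq_trans (leH p)) ?leq_addl.
    have -> : wset_of D - W0 = wset_of (D ++ DA) - W1.
      by rewrite wset_of_cat /W0 opprB addrA.
    apply: effective_sub => p.
    have /memv_addP[_ /vlineP[a ->] [_ /vlineP[b ->] Ephi]] := phiS.
    set k := minn (count_mem p (DF ++ DH)) (count_mem p (DG ++ DH)).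
    have : ord_ge t p k e phi.
      rewrite Ephi formZD; apply: ord_ge_lin.
        by apply: (ord_geW tP) (ord_eqW (o1 p)); rewrite geq_minl.
      have -> : ((b *: phi2 : Defs.form L w e) : P) = b *: (phi2 : P) + 0 by rewrite addr0.
      apply: ord_ge_lin; first by apply: (ord_geW tP) (ord_eqW (o2 p)); rewrite geq_minr.
      by apply: ord_ge_van => q; rewrite meval0.
    move/(ord_eq_ge tP (form_homog phi) (oD p)); rewrite /k !count_cat => le.
    by move: le (cnt p); clear; lia.
  + split=> //; rewrite /W0 /W1 degB !deg_wset_of.
    by rewrite -(mP _ _ _ (form_homog phi1) n1 o1) subKr.
split.
  by exists W1; [exists phi1 | rewrite /W0 subKr].
exists W2; first by exists phi2.
have E : wset_of DF + wset_of DB = wset_of DG + wset_of DA.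
  by rewrite -!wset_of_cat; apply: wset_eq => p; rewrite !coeff_wset_of !count_cat cnt.
rewrite /W0 /W1 /W2 !wset_of_cat opprB addrA.
by rewrite [_ + wset_of DA]addrAC -E [_ + wset_of DB]addrC -[_ + _ + wset_of DH]addrA addrK.
Qed.

End Translation.

Theorem mainTheorem7 (L : closedFieldType) (w : nat) (C : curve L w)
    (smoothC : smooth C) (A B : wset C) (degAB : deg A = deg B) :
  lin_equiv A B <->
  (exists2 g : ratfun C, ~ eq_gen C g (fun=> 0) & is_div g (A - B)).
Proof.
have [t tP] := choice (fun p => local_parameter_exists (smoothC _ (valP p))).
split; first exact: (lin_equiv_div tP).
by move=> [g ng gdiv]; exact: (div_lin_equiv tP degAB ng gdiv).
Qed.
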